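(* Let $E\subset X$ be of finite perimeter. Let $\Gamma$ be the collection of curves $\gamma$ in $X$ such that there exist $t_0,t_1\in[0,\ell_\gamma]$ with $t_0<t_1$ and either (1) $\gamma(t_0)\in\mathcal I(E)$, $\gamma(t_1)\in\mathcal E(E)$ and $\gamma([t_0,t_1])\cap\partial^*E$ is empty, or (2) $\gamma(t_0)\in\mathcal E(E)$, $\gamma(t_1)\in\mathcal I(E)$ and $\gamma([t_0,t_1])\cap\partial^*E$ is empty. Then $\mathrm{Mod}_1(\Gamma)=0$.
   Context: Standing assumptions: $(X,d,\mu)$ is a complete metric space with a Borel regular outer measure $\mu$ that is doubling (there is $C_d\ge 1$ with $0<\mu(B(x,2r))\le C_d\,\mu(B(x,r))<\infty$ for all $x\in X$, $r>0$) and supports a $(1,1)$-Poincaré inequality: there are $C_P>0$, $\lambda\ge 1$ such that for every ball $B(x,r)$, every locally integrable $u$ on $X$ and every upper gradient $g$ of $u$, $\frac{1}{\mu(B(x,r))}\int_{B(x,r)}|u-u_{B(x,r)}|\,d\mu\le C_P\, r\,\frac{1}{\mu(B(x,\lambda r))}\int_{B(x,\lambda r)}g\,d\mu$, where $u_B=\frac1{\mu(B)}\int_B u\,d\mu$. A curve is a rectifiable continuous map from a compact interval into $X$; every curve $\gamma$ is parametrized by arc length, with length $\ell_\gamma$, so it is defined on $[0,\ell_\gamma]$. A nonnegative Borel function $g$ is an upper gradient of an extended real-valued function $u$ if $|u(x)-u(y)|\le\int_\gamma g\,ds$ for all curves $\gamma$ with end points $x,y$ (with $|u(x)-u(y)|=\infty$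 if at least one of the values is infinite). For $u\in L^1_{\mathrm{loc}}(X)$, $\|Du\|(X):=\inf\{\liminf_{i}\int_X g_{u_i}\,d\mu: u_i\in \mathrm{Lip}_{\mathrm{loc}}(X),\ u_i\to u \text{ in } L^1_{\mathrm{loc}}(X)\}$, each $g_{u_i}$ being an upper gradient of $u_i$. A measurable $E\subset X$ is of finite perimeter if $\|D\chi_E\|(X)<\infty$. $\mathcal I(E)$, respectively $\mathcal E(E)$, is the set of $x\in X$ with $\lim_{r\to0^+}\mu(B(x,r)\cap E)/\mu(B(x,r))=1$, respectively $=0$; $\partial^*E$ is the set of points at which both $E$ and $X\setminus E$ have positive upper density, so that $\partial^*E=X\setminus(\mathcal I(E)\cup\mathcal E(E))$. The $1$-modulus of a curve family $\Gamma$ is $\mathrm{Mod}_1(\Gamma):=\inf\int_X\rho\,d\mu$ over all nonnegative Borel $\rho$ on $X$ with $\int_\gamma\rho\,ds\ge1$ for every $\gamma\in\Gamma$. *)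

(* Defs.v *)
From HB Require Import structures.
From mathcomp Require Import all_boot all_order all_algebra.
From mathcomp Require Import all_classical all_reals all_analysis.
From mathcomp Require Import measurable_realfun.

Set Implicit Arguments.
Unset Strict Implicit.
Unset Printing Implicit Defensive.
Import Order.TTheory GRing.Theory Num.Theory.
Import numFieldNormedType.Exports.
Local Open Scope classical_set_scope.
Local Open Scope ring_scope.

#[short(type="completeMetricType")]
HB.structure Definition CompleteMetric (R : numDomainType) :=
  {T of Complete T & Metric R T}.

Section curves.
Context {R : realType} {X : metricType R}.

(* The metric-valued counterpart of `variations` and `total_variation`, which
   the library only provides for functions from R to R. *)
Definition path_length (a b : R) (p : R -> X) : \bar R :=
  ereal_sup [set (let F := p \o nth b (a :: s) in
                  \sum_(0 <= n < size s) mdist (F n) (F n.+1))%:E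
            | s in itv_partition a b].

(* Curves are parametrized by arc length on [0, len]; the values of the
   underlying function outside this interval are irrelevant.  Rectifiability is
   the instance t = len of `arc_length_param`. *)
Record curve := Curve {
  len : R ;
  curve_fun :> R -> X ;
  len_ge0 : 0 <= len ;
  curve_continuous : {within `[0, len], continuous curve_fun} ;
  arc_length_param : forall t, t \in `[0, len] ->
    path_length 0 t curve_fun = t%:E }.

Definition curve_integral (gamma : curve) (g : X -> \bar R) : \bar R :=
  (\int[@lebesgue_measure R]_(s in `[0%R, len gamma]) g (gamma s))%E.

End curves.
Arguments curve {R} X.

Section metric_measure_space.
Context {R : realType} {X : completeMetricType R}.
Implicit Types (mu : {outer_measure set X -> \bar R}) (u g : X -> \bar R).
Local Open Scope ereal_scope.

Definition borel_set (A : set X) : Prop := <<s @open X >> A.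

Definition nonneg_borel_fun g : Prop :=
  measurable_fun [set: g_sigma_algebraType (@open X)] g /\ forall x, 0 <= g x.

Definition borel_regular mu : Prop :=
  (forall A, borel_set A -> mu.-caratheodory A) /\
  (forall A, exists B, [/\ borel_set B, A `<=` B & mu B = mu A]).

Definition doubling mu : Prop :=
  exists Cd : R, (1 <= Cd)%R /\
    forall (x : X) (r : R), (0 < r)%R ->
      [/\ 0 < mu (ball x (2 * r)%R),
          mu (ball x (2 * r)%R) <= Cd%:E * mu (ball x r) &
          Cd%:E * mu (ball x r) < +oo].

(* Integrals against mu are taken over the sigma-algebra of the
   Caratheodory-measurable sets. *)
Definition mint mu (A : set X) (u : X -> \bar R) : \bar R :=
  \int[mu : set (caratheodory_type mu) -> \bar R]_(x in A) u x.

Definition avg mu (A : set X) u : \bar R := (mu A)^-1 * mint mu A u.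

Definition L1_loc mu u : Prop :=
  forall x : X, exists2 r : R, (0 < r)%R &
    (mu : set (caratheodory_type mu) -> \bar R).-integrable (ball x r) u.

(* Since +oo - +oo = -oo - -oo = -oo in \bar R, the left-hand side
   is +oo as soon as one of the two values of u is infinite, as it should be. *)
Definition upper_gradient u g : Prop :=
  nonneg_borel_fun g /\
  forall gamma : curve X,
    `|u (gamma 0%R) - u (gamma (len gamma))| <= curve_integral gamma g.

Definition poincare_1_1 mu : Prop :=
  exists CP lambda : R, [/\ (0 < CP)%R, (1 <= lambda)%R &
    forall (x : X) (r : R) u g, (0 < r)%R ->
      L1_loc mu u -> upper_gradient u g ->
      avg mu (ball x r) (fun y => `|u y - avg mu (ball x r) u|) <=
      (CP * r)%:E * avg mu (ball x (lambda * r)%R) g].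

Definition locally_lipschitz (v : X -> R) : Prop :=
  forall x : X, exists2 r : R, (0 < r)%R &
    exists L : R, forall y z, ball x r y -> ball x r z ->
      (`|v y - v z| <= L * mdist y z)%R.

Definition cvg_L1_loc mu (v : nat -> X -> R) u : Prop :=
  forall x : X, exists2 r : R, (0 < r)%R &
    mint mu (ball x r) (fun y => `|(v i y)%:E - u y|) @[i --> \oo] --> 0.

(* ||Du||(X); only meaningful for locally integrable u. *)
Definition variation_norm mu u : \bar R :=
  ereal_inf [set l | exists (v : nat -> X -> R) (g : nat -> X -> \bar R),
    [/\ forall i, locally_lipschitz (v i),
        cvg_L1_loc mu v u,
        forall i, upper_gradient (EFin \o v i) (g i) &
        l = limn_einf (fun i => mint mu setT (g i))]].

Definition finite_perimeter mu (E : set X) : Prop :=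
  mu.-caratheodory E /\ variation_norm mu (EFin \o \1_E) < +oo.

Definition density_ratio mu (E : set X) (x : X) (r : R) : \bar R :=
  mu (ball x r `&` E) * (mu (ball x r))^-1.

Definition measure_interior mu (E : set X) : set X :=
  [set x | density_ratio mu E x r @[r --> 0%R^'+] --> 1].

Definition measure_exterior mu (E : set X) : set X :=
  [set x | density_ratio mu E x r @[r --> 0%R^'+] --> 0].

Definition upper_density mu (E : set X) (x : X) : \bar R :=
  limf_esup (density_ratio mu E x) 0%R^'+.

Definition measure_boundary mu (E : set X) : set X :=
  [set x | 0 < upper_density mu E x /\ 0 < upper_density mu (~` E) x].

Definition modulus1 mu (Gamma : set (curve X)) : \bar R :=
  ereal_inf [set mint mu setT rho | rho in
    [set rho | nonneg_borel_fun rho /\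
       forall gamma, Gamma gamma -> 1 <= curve_integral gamma rho]].

End metric_measure_space.

(* Main.v *)
Require Import Defs.
From mathcomp Require Import all_boot all_order all_algebra.
From mathcomp Require Import all_classical all_reals all_analysis.
From mathcomp Require Import measurable_realfun.
From mathcomp Require Import ring lra.
Set Implicit Arguments.
Unset Strict Implicit.
Unset Printing Implicit Defensive.
Import Order.TTheory GRing.Theory Num.Theory.
Import numFieldNormedType.Exports.
Local Open Scope classical_set_scope.
Local Open Scope ring_scope.

(** Call a ball mixed if both [E] and its complement fill at least a fixed
    fraction of it.  Take locally Lipschitz functions [v i] converging to the
    characteristic function of [E], with upper gradients [g i] of integral at
    most [M].  The Poincare inequality for [v i], in the limit, is a relative
    isoperimetric inequality: for mixed balls [B_l] of radii [r_l] whose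
    enlargements [lam B_l] are disjoint and contained in [G], the sum of the
    [mu (B_l) / r_l] is at most a constant times the lower limit of the integrals
    of [g i] over [G] ([sum_isoperimetric]).

    The heart of the proof is [thin_near_uniform_density].  Let [D] be a set of
    points around which, in all balls of radius less than some [kappa], one of
    [E] and its complement fills all but a tiny fraction of the ball, the [v i]
    converging in L1 on the balls of radius [kappa].  Then [D] has
    neighbourhoods [U] in which the sum above is as small as desired, although
    the [g i] may put mass there.  To see this, replace [v i] by a function
    [plateau r], built from [E] at a small scale [r]: it is [2 / r]-Lipschitz,
    close to the characteristic function of [E], and locally constant away from
    the mixed balls of radius [2 r].  Those mixed balls stay away from the
    [r]-neighbourhood of [D], so the integral over [U] of the gradient of
    [plateau r] is controlled by the integral of [g i] over a neighbourhood of
    [D] minus the [r]-neighbourhood.  A pigeonhole argument over the scales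
    ([pigeonhole_scale]) makes the latter small, uniformly in [r].

    The points off the measure-theoretic boundary form a countable union of such
    sets [D k]; take neighbourhoods [U k] with bounds [eps / 2 ^ k.+1].  Consider
    a curve that goes from the measure-theoretic interior to the exterior, or
    back, off the boundary.  If it met no centre of a small mixed ball contained
    in some [U k], then which of [E] and its complement has vanishing density
    would be locally constant along it ([vanishing_locally_constant]),
    contradicting the connectedness of an interval.  Hence every such curve meets
    the set of these centres.  Vitali's covering lemma selects disjoint balls
    [lam B_l] whose threefold enlargements cover this set; the function
    [sum_l (lam r_l)^-1 1_(4 lam B_l)] has integral at most a constant times
    [eps], and integral at least 1 along every such curve whose diameter is large
    compared with the radii ([exists_weight]).  Summing these functions over a
    sequence of scales tending to 0 gives arbitrarily small admissible weights
    for all the curves. *)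

(** * Balls, separated sets and tents in metric spaces *)

Section metric_geometry.
Context {R : realType} {X : metricType R}.
Implicit Types (x y z : X) (r : R) (s : seq X) (A V : set X).

Lemma in_ball x r y : ball x r y = (mdist x y < r) :> Prop.
Proof.
by rewrite ballEmdist.
Qed.

Lemma sub_ball x y r (s : R) : mdist x y + s <= r -> ball y s `<=` ball x r.
Proof.
move=> h z; rewrite !in_ball => yz.
have := metric_triangle x y z; lra.
Qed.

Lemma open_ball x r : open (ball x r).
Proof.
rewrite openE => y; rewrite in_ball => xy; apply/nbhs_ballP.
exists (r - mdist x y) => /=; first by rewrite subr_gt0.
by apply: sub_ball; lra.
Qed.

Lemma ball_meet x y r (s : R) : ball x r `&` ball y s !=set0 -> mdist x y < r + s.
Proof.
move=> [z [] /=]; rewrite !in_ball => xz yz.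
have := metric_triangle x z y; rewrite (metric_sym z y); lra.
Qed.

(** Vitali's covering lemma: a family of balls of bounded radii contains a
    disjoint subfamily whose threefold enlargements contain all the centres. *)
Lemma vitali_covering A (rad : X -> R) (r0 : R) :
  (forall x, A x -> 0 < rad x <= r0) ->
  exists V, [/\ V `<=` A, trivIset V (fun x => ball x (rad x)) &
    forall x, A x -> exists2 y, V y & mdist y x < 3 * rad y].
Proof.
move=> radA.
pose meets x y := ball x (rad x) `&` ball y (rad y) !=set0.
(* Federer's property: a ball of the family that meets the subfamily meets one
   of its balls of at least half the radius.  A maximal subfamily with this
   property meets every ball, since otherwise a remaining ball of almost
   maximal radius could be added. *)
pose P V := [/\ V `<=` A, trivIset V (fun x => ball x (rad x)) &
  forall x, A x -> (exists2 y, V y & meets x y) ->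
    exists y, [/\ V y, meets x y & rad x <= 2 * rad y]].
have [V [[VA tV hV] maxV]] : exists V, P V /\ forall W, V `<` W -> ~ P W.
  apply: Zorn_bigcup => F FP totF; split.
  - by move=> x [V /FP[VA _ _] Vx]; exact: VA.
  - move=> x y [V FV Vx] [W FW Wy] xy.
    have [VW|WV] := totF _ _ FV FW.
    + by have [_ tW _] := FP _ FW; apply: tW => //; exact: VW.
    + by have [_ tW _] := FP _ FV; apply: tW => //; exact: WV.
  - move=> x Ax [y [V FV Vy] xy].
    have [_ _ /(_ x Ax)] := FP _ FV.
    case=> [|z [Vz xz rz]]; first by exists y.
    by exists z; split => //; exists V.
exists V; split => // x Ax.
have [[y Vy xy]|xV] := pselect (exists2 y, V y & meets x y).
  have [|{}y [{}Vy {}xy rxy]] := hV x Ax; first by exists y.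
  by exists y => //; have := ball_meet xy; rewrite metric_sym; lra.
exfalso.
pose A' := [set z | A z /\ ~ exists2 y, V y & meets z y].
have [z [A'z zmax]] : exists z, A' z /\ forall w, A' w -> rad w <= 2 * rad z.
  pose S := rad @` A'.
  have supS : has_sup S.
    split; first by exists (rad x); exists x.
    by exists r0 => _ [w [/radA/andP[_ ?] _] <-].
  have S0 : 0 < sup S.
    apply: lt_le_trans (ub_le_sup supS.2 (_ : S (rad x))).
      by have /andP[] := radA _ Ax.
    by exists x.
  have [_ [z A'z <-] hz] := @sup_adherent _ S (sup S / 2) (divr_gt0 S0 (ltr0Sn _ 1)) supS.
  exists z; split => // w A'w.
  have : rad w <= sup S by apply: (ub_le_sup supS.2); exists w.
  lra.
have [Az zV] := A'z.
have rz : 0 < rad z by have /andP[] := radA _ Az.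
have zz : meets z z by exists z; split; rewrite in_ball mdistxx.
apply: (maxV (z |` V)).
  split; first by move=> ? ?; right.
  by move=> zVV; apply: zV; exists z => //; apply: zVV; left.
split.
- by move=> w [->//|/VA].
- move=> a b [->|Va] [->|Vb]//= ab.
  + by exfalso; apply: zV; exists b.
  + by exfalso; apply: zV; exists a => //; rewrite /meets setIC.
  + exact: tV.
- move=> w Aw [y [->|Vy] wy].
  + have [wV|wV] := pselect (exists2 y, V y & meets w y).
      have [y' [? ? ?]] := hV w Aw wV.
      by exists y'; split => //; right.
    by exists z; split => //; [left|apply: zmax].
  + have [|y' [? ? ?]] := hV w Aw; first by exists y.
    by exists y'; split => //; right.
Qed.

(** The points of the sequence [s] have mutual distances at least [r]. *)
Definition separated r (s : seq X) : bool :=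
  pairwise (fun x y => r <= mdist x y) s.

Lemma separated_uniq r s : 0 < r -> separated r s -> uniq s.
Proof.
move=> r0; rewrite uniq_pairwise; apply: sub_pairwise => x y /=.
by apply: contraTneq => ->; rewrite mdistxx -ltNge.
Qed.

Lemma separated_disjoint r s : separated r s ->
  trivIset [set` s] (fun x => ball x (r / 2)).
Proof.
move=> seps x y /= xs ys xy.
move/(pairwiseP x) : seps => seps.
have := ball_meet xy; rewrite -splitr.
rewrite -(nth_index x xs) -(nth_index x ys).
have xi : (index x s < size s)%N by rewrite index_mem.
have yi : (index y s < size s)%N by rewrite index_mem.
case: (ltngtP (index x s) (index y s)) => [xy'|yx'|->//].
- by rewrite ltNge seps.
- by rewrite metric_sym ltNge seps.
Qed.

(** A maximal [r]-separated sequence of points of [A] is an [r]-net of [A]. *)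
Lemma exists_net r A (N : nat) :
  (forall s, separated r s -> [set` s] `<=` A -> (size s <= N)%N) ->
  exists s, [/\ separated r s, [set` s] `<=` A &
    forall x, A x -> exists2 y, y \in s & mdist y x < r].
Proof.
move=> hN.
pose P n := `[< exists s, [/\ separated r s, [set` s] `<=` A & size s = n] >].
have exP : exists n, P n by exists 0%N; apply/asboolP; exists [::]; split.
have ubP n : P n -> (n <= N)%N by move=> /asboolP[s [? ? <-]]; exact: hN.
case: (ex_maxnP exP ubP) => n /asboolP[s [ss sA sn]] nmax.
exists s; split => // x Ax; apply: contrapT => hx.
suff /nmax : P n.+1 by rewrite ltnn.
apply/asboolP; exists (x :: s); split => /=; last by rewrite sn.
- rewrite /separated /= -/(separated r s) ss andbT; apply/allP => y ys.
  by rewrite leNgt; apply/negP; rewrite metric_sym => xy; apply: hx; exists y.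
- by move=> y /=; rewrite inE => /orP[/eqP->//|]; exact: sA.
Qed.

(** The smallest nonnegative [K]-Lipschitz function that is at least 1 on [H];
    the value 0 is put in the supremum, so that [tent set0 K] is 0. *)
Definition tent (H : set X) (K : R) (x : X) : R :=
  sup (0 |` [set 1 - K * mdist x h | h in H]).

Section tent.
Context (H : set X) (K : R) (K0 : 0 <= K).

Let tent_has_sup x : has_sup (0 |` [set 1 - K * mdist x h | h in H]).
Proof.
split; first by exists 0; left.
exists 1 => _ [->//|[h _ <-]].
by have := mulr_ge0 K0 (mdist_ge0 x h); lra.
Qed.

Let tent_le x b : 0 <= b -> (forall h, H h -> 1 - K * mdist x h <= b) ->
  tent H K x <= b.
Proof.
move=> b0 hb; apply: ge_sup; first by exists 0; left.
by move=> _ [->//|[h Hh <-]]; exact: hb.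
Qed.

Let le_tent x h : H h -> 1 - K * mdist x h <= tent H K x.
Proof.
by move=> Hh; apply: (ub_le_sup (tent_has_sup x).2); right; exists h.
Qed.

Lemma tent_ge0 x : 0 <= tent H K x.
Proof.
by apply: (ub_le_sup (tent_has_sup x).2); left.
Qed.

Lemma tent_le1 x : tent H K x <= 1.
Proof.
apply: tent_le => // h _.
by have := mulr_ge0 K0 (mdist_ge0 x h); lra.
Qed.

Lemma tent_eq1 x : H x -> tent H K x = 1.
Proof.
move=> Hx; apply/eqP; rewrite eq_le tent_le1/=.
by have := le_tent x Hx; rewrite mdistxx mulr0 subr0.
Qed.

Lemma tent_eq0 x : (forall h, H h -> 1 <= K * mdist x h) -> tent H K x = 0.
Proof.
move=> Hx; apply/eqP; rewrite eq_le tent_ge0 andbT.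
by apply: tent_le => // h /Hx; lra.
Qed.

Lemma tent_lip x y : `|tent H K x - tent H K y| <= K * mdist x y.
Proof.
suff hle a b : tent H K a <= tent H K b + K * mdist a b.
  have := hle x y; have := hle y x; rewrite (metric_sym y x) ler_norml; lra.
apply: tent_le => [|h Hh].
  by rewrite addr_ge0 ?tent_ge0// mulr_ge0 ?mdist_ge0.
have := le_tent b Hh.
have := ler_wpM2l K0 (metric_triangle b a h); rewrite (metric_sym b a); lra.
Qed.

End tent.

(** Curves are 1-Lipschitz, being parametrized by arc length. *)
Lemma curve_lip (gamma : curve X) (s t : R) : 0 <= s -> s <= t -> t <= len gamma ->
  mdist (gamma s) (gamma t) <= t - s.
Proof.
move=> s0 st tl.
have sl : s <= len gamma by exact: le_trans tl.
have t0 : 0 <= t by exact: le_trans st.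
move: st; rewrite le_eqVlt => /predU1P[->|st].
  by rewrite mdistxx subrr.
have At := arc_length_param (c := gamma) (t := t).
have As := arc_length_param (c := gamma) (t := s).
rewrite in_itv/= t0 tl in At; rewrite in_itv/= s0 sl in As.
have {At}At := At isT; have {As}As := As isT.
suff : (path_length 0 s gamma <= (t - mdist (gamma s) (gamma t))%:E)%E.
  by rewrite As lee_fin; lra.
apply: ub_ereal_sup => _ [p [pp /eqP lp] <-] /=.
rewrite lee_fin lerBrDr -lee_fin -At.
apply: ereal_sup_ubound; exists (rcons p t).
  split; last by rewrite last_rcons.
  by rewrite rcons_path pp/= lp.
congr (_%:E); rewrite /= size_rcons big_nat_recr//=; congr (_ + _); last first.
  rewrite [in X in mdist _ X]nth_rcons ltnn eqxx -rcons_cons nth_rcons/= ltnS.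
  by rewrite leqnn -[in RHS]lp (last_nth t).
apply: eq_big_nat => i /andP[_ ip].
rewrite -rcons_cons !nth_rcons ip (_ : (i < size (0%R :: p))%N); last exact: ltnW.
by rewrite (set_nth_default s t)/= ?ltnS 1?ltnW// (set_nth_default s t).
Qed.

End metric_geometry.

(** * Curves and upper gradients *)

Section curves.
Context {R : realType} {X : completeMetricType R}.

Local Notation borelX := (g_sigma_algebraType (@open X)).

Lemma curve_measurable (gamma : curve X) :
  measurable_fun `[0, len gamma]
    (gamma : R -> g_sigma_algebraType (@open X)).
Proof.
apply: (@measurability _ _ _ borelX _ _ (@open X)) => // _ [U oU <-].
have /open_subspaceP[V oV VE] := proj1 (@continuousP (subspace `[0, len gamma]) X gamma)
  (@curve_continuous _ _ gamma) U oU.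
rewrite setIC -VE; apply: measurableI => //.
exact: open_measurable.
Qed.



Local Open Scope ereal_scope.

Lemma curve_comp_measurable (gamma : curve X) (g : X -> \bar R) (a b : R) :
  nonneg_borel_fun g -> (0 <= a)%R -> (b <= len gamma)%R ->
  measurable_fun `[a, b] (g \o gamma).
Proof.
move=> [mg _] a0 bl.
have mgg : measurable_fun `[0%R, len gamma] (g \o (gamma : R -> borelX)).
  by apply: (@measurable_comp _ _ _ _ borelX _ setT) => //; exact: curve_measurable.
apply: (measurable_funS _ _ mgg) => //.
by move=> t /=; rewrite !in_itv/= => /andP[? ?]; rewrite (le_trans a0)//= (le_trans _ bl).
Qed.

(** A curve that stays in the set where [g >= K] during a time interval of
    length [d] has curve integral at least [K * d]. *)
Lemma curve_integral_ge (gamma : curve X) (g : X -> \bar R) (a b K : R) :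
  nonneg_borel_fun g -> (0 <= K)%R -> (0 <= a)%R -> (a <= b)%R -> (b <= len gamma)%R ->
  (forall t, (a < t < b)%R -> K%:E <= g (gamma t)) ->
  (K * (b - a))%:E <= curve_integral gamma g.
Proof.
move=> bg K0 a0 ab bl hK.
have sub : `]a, b[ `<=` `[0%R, len gamma].
  by move=> t /=; rewrite !in_itv/= => /andP[? ?]; apply/andP; split; lra.
have mg := curve_comp_measurable bg (lexx 0%R) (lexx (len gamma)).
rewrite /curve_integral.
apply: (@le_trans _ _ (\int[lebesgue_measure]_(s in `]a, b[) g (gamma s))); last first.
  apply: ge0_subset_integral => //.
  by move=> t _; exact: bg.2.
apply: (@le_trans _ _ (\int[lebesgue_measure]_(s in `]a, b[) K%:E)).
  rewrite integral_cst//= lebesgue_measure_itv/= lte_fin.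
  move: ab; rewrite le_eqVlt => /predU1P[->|->]; last by [].
  by rewrite ltxx subrr mulr0 mule0.
apply: ge0_le_integral => //.
by apply: (measurable_funS _ sub mg).
Qed.

(** A Lipschitz function that is constant on every ball of radius [eta] centred
    outside a Borel set [Z] has the upper gradient [K 1_Z]: a curve is cut into
    pieces shorter than [eta], and a piece either lies in [Z] or carries no
    variation of the function. *)
Lemma upper_gradient_lip (f : X -> R) (K eta : R) (Z : set X) :
  (0 <= K)%R -> (0 < eta)%R -> borel_set Z ->
  (forall x y, `|f x - f y| <= K * mdist x y)%R ->
  (forall x, ~ Z x -> forall y, ball x eta y -> f y = f x) ->
  upper_gradient (EFin \o f) (fun x => (K * \1_Z x)%:E).
Proof.
move=> K0 eta0 bZ flip fcst.
pose g := fun x : X => (K * \1_Z x)%:E.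
have bg : nonneg_borel_fun g.
  split; last by move=> x; rewrite lee_fin mulr_ge0.
  apply/measurable_EFinP; apply: measurable_funM => //.
split => // gamma /=.
have l0 := len_ge0 gamma.
pose N := (Num.truncn (len gamma / eta)).+1.
pose h := (len gamma / N%:R)%R.
have N0 : (0 < N%:R :> R)%R by rewrite ltr0n.
have h0 : (0 <= h)%R by rewrite divr_ge0.
have heta : (h < eta)%R.
  by rewrite /h ltr_pdivrMr// mulrC -ltr_pdivrMr// truncnS_gt.
have hN : (N%:R * h = len gamma)%R by rewrite /h mulrCA divff ?mulr1// gt_eqF.
suff main n : (n <= N)%N ->
    `|f (gamma 0%R) - f (gamma (n%:R * h)%R)|%:E <=
    \int[lebesgue_measure]_(s in `[0%R, (n%:R * h)%R]) g (gamma s).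
  by have := main N (leqnn N); rewrite hN.
elim: n => [_|n IH nN].
  rewrite mul0r subrr normr0; apply: integral_ge0 => t _; exact: bg.2.
have nl : (n.+1%:R * h <= len gamma)%R by rewrite -hN ler_wpM2r// ler_nat.
have nE : (n.+1%:R * h = n%:R * h + h)%R by rewrite -natr1 mulrDl mul1r.
have nh0 : (0 <= n%:R * h)%R by rewrite mulr_ge0.
set a := (n%:R * h)%R in IH nE nh0 *; set b := (n.+1%:R * h)%R in nl nE *.
have ab : (a <= b)%R by lra.
apply: (@le_trans _ _ (`|f (gamma 0%R) - f (gamma a)|%:E + `|f (gamma a) - f (gamma b)|%:E)).
  by rewrite -EFinD lee_fin; exact: ler_distD.
rewrite (_ : `[0%R, b]%classic = `[0%R, a] `|` `]a, b]); last first.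
  apply/seteqP; split => t /=; rewrite !in_itv/=.
    by move=> /andP[? ?]; case: (leP t a) => ?; [left|right]; apply/andP; split; lra.
  by move=> [|] /andP[? ?]; apply/andP; split; lra.
have mg := curve_comp_measurable bg (lexx 0%R) nl.
rewrite ge0_integral_setU//=; last 3 first.
- apply: measurable_funS mg => //.
  by move=> t /= [|]; rewrite !in_itv/= => /andP[? ?]; apply/andP; split; lra.
- by move=> t _; exact: bg.2.
- by apply/disj_setPS => t /= []; rewrite !in_itv/= => /andP[? ?] /andP[? ?]; lra.
apply: leeD; first by apply: IH; exact: ltnW.
have [allZ|] := pselect (forall t, (a <= t <= b)%R -> Z (gamma t)); last first.
  move=> /existsNP[t /not_implyP[/andP[at_ tb] nZ]].
  have near s : (a <= s <= b)%R -> f (gamma s) = f (gamma t).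
    move=> /andP[as_ sb]; apply: fcst => //; rewrite in_ball.
    have [st|ts] := leP s t.
      rewrite metric_sym; apply: (@le_lt_trans _ _ (t - s)%R); last by lra.
      by apply: curve_lip => //; lra.
    apply: (@le_lt_trans _ _ (s - t)%R); last by lra.
    by apply: curve_lip => //; lra.
  rewrite (near a) ?lexx// (near b) ?lexx ?ab// subrr normr0.
  by apply: integral_ge0 => s _; exact: bg.2.
apply: (@le_trans _ _ (\int[lebesgue_measure]_(s in `]a, b]) K%:E)).
  rewrite integral_cst//= lebesgue_measure_itv/= lte_fin.
  apply: (@le_trans _ _ (K * mdist (gamma a) (gamma b))%:E); first by rewrite lee_fin.
  move: ab; rewrite le_eqVlt => /predU1P[->|ab].
    by rewrite ltxx mdistxx mulr0 mule0.
  by rewrite ab -EFinD -EFinM lee_fin ler_wpM2l// curve_lip// ltW.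
apply: ge0_le_integral => //.
- apply: measurable_funS mg => //.
  by move=> t /=; rewrite !in_itv/= => /andP[? ?]; apply/andP; split; lra.
- move=> t /=; rewrite in_itv/= => /andP[at_ tb].
  by rewrite /g indicE mem_set ?mulr1//; apply: allZ; rewrite tb ltW.
Qed.

End curves.

(** * Finite families of sets with bounded overlap *)

Lemma count_trivIset (T : Type) (I : eqType) (F : I -> set T) (s : seq I) (y : T) :
  uniq s -> trivIset [set` s] F -> (count (fun i => y \in F i) s <= 1)%N.
Proof.
move=> us tF; rewrite -size_filter.
have := filter_uniq (fun i => y \in F i) us.
have : forall i, i \in [seq i <- s | y \in F i] -> i \in s /\ F i y.
  by move=> i; rewrite mem_filter => /andP[/set_mem].
case: [seq i <- s | y \in F i] => [//|i [//|j t]] hs /=.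
have [si Fi] := hs i (mem_head _ _).
have [sj Fj] := hs j ltac:(by rewrite !inE eqxx orbT).
suff -> : i = j by rewrite mem_head.
by apply: tF => //; exists y.
Qed.

Section finite_overlap.
Context d (T : measurableType d) {R : realType} (nu : {measure set T -> \bar R}).
Context (I : eqType).
Local Open Scope ereal_scope.

Lemma sum_patch (F : I -> set T) (f : T -> \bar R) (s : seq I) (y : T) :
  (forall y, 0 <= f y) ->
  \sum_(i <- s) (f \_ (F i)) y = (count (fun i => y \in F i) s)%:R%:E * f y.
Proof.
move=> f0; elim: s => [|i s IH]; first by rewrite big_nil mul0e.
rewrite big_cons IH /= /patch natrD EFinD ge0_muleDl ?lee_fin//.
by case: ifP => _; rewrite ?mul1e ?mul0e.
Qed.

(** Summing integrals over finitely many sets that overlap at most [N] times. *)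
Lemma sum_integral_overlap (F : I -> set T) (W : set T) (f : T -> \bar R)
    (s : seq I) (N : nat) :
  (forall i, measurable (F i)) -> measurable W ->
  measurable_fun setT f -> (forall y, 0 <= f y) ->
  (forall i, i \in s -> F i `<=` W) ->
  (forall y, (count (fun i => y \in F i) s <= N)%N) ->
  \sum_(i <- s) \int[nu]_(y in F i) f y <= N%:R%:E * \int[nu]_(y in W) f y.
Proof.
move=> mF mW mf f0 FW FN.
have mp A : measurable A -> measurable_fun setT (f \_ A).
  by move=> mA; apply/(measurable_restrictT _ mA); exact: measurable_funTS.
have p0 A y : 0 <= (f \_ A) y by rewrite /patch; case: ifP.
under eq_bigr do rewrite integral_mkcond.
rewrite -ge0_integral_sum//; [|by move=> i; exact: mp].
rewrite (integral_mkcond W) -ge0_integralZl//; [|exact: mp].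
apply: ge0_le_integral => //.
- by move=> y _; exact: sume_ge0.
- by apply: emeasurable_sum => i; exact: mp.
- by apply: measurable_funeM; exact: mp.
move=> y _; rewrite sum_patch// /patch; case: ifPn => yW.
  by rewrite lee_wpmul2r// lee_fin ler_nat.
rewrite mule0 (_ : count _ s = 0%N) ?mul0e//.
apply/eqP; rewrite -leqn0 leqNgt -has_count; apply/hasPn => i si.
by apply: contra yW; rewrite !inE; exact: FW.
Qed.

End finite_overlap.

(** * Doubling measures *)

Section doubling.
Context {R : realType} {X : completeMetricType R}.
Context (mu : {outer_measure set X -> \bar R}).
Implicit Types (x y z : X) (r : R) (A B : set X).

Local Notation m := (mu : set (caratheodory_type mu) -> \bar R).

(** The measure of a set as a real number; it is only used for subsets of
    balls, whose measure is finite, and is 0 on sets of infinite measure. *)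
Definition vol A : R := fine (mu A).

Lemma vol_ge0 A : 0 <= vol A.
Proof.
by apply: fine_ge0; exact: outer_measure_ge0.
Qed.

Context (mu_regular : borel_regular mu).

Lemma borel_measurable A : borel_set A -> measurable (A : set (caratheodory_type mu)).
Proof.
exact: mu_regular.1.
Qed.

Lemma open_measurable A : open A -> measurable (A : set (caratheodory_type mu)).
Proof.
by move=> oA; apply: borel_measurable; exact: sub_sigma_algebra.
Qed.

Lemma ball_measurable x r : measurable (ball x r : set (caratheodory_type mu)).
Proof.
by apply: open_measurable; exact: open_ball.
Qed.

Lemma mint_sum_overlap (I : eqType) (F : I -> set X) (W : set X)
    (f : X -> \bar R) (s : seq I) (N : nat) :
  (forall i, measurable (F i : set (caratheodory_type mu))) ->
  measurable (W : set (caratheodory_type mu)) ->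
  measurable_fun setT (f : caratheodory_type mu -> \bar R) ->
  (forall y, 0 <= f y)%E ->
  (forall i, i \in s -> F i `<=` W) ->
  (forall y, (count (fun i => y \in F i) s <= N)%N) ->
  (\sum_(i <- s) mint mu (F i) f <= N%:R%:E * mint mu W f)%E.
Proof.
exact: (@sum_integral_overlap _ (caratheodory_type mu) R m I F W f s N).
Qed.

Lemma mint_cst A (c : \bar R) : measurable (A : set (caratheodory_type mu)) ->
  mint mu A (cst c) = (c * mu A)%E.
Proof.
by move=> mA; rewrite /mint integral_cst.
Qed.

Lemma sum_mu_disjoint (I : eqType) (F : I -> set X) (W : set X) (s : seq I) :
  (forall i, measurable (F i : set (caratheodory_type mu))) ->
  measurable (W : set (caratheodory_type mu)) ->
  (forall i, i \in s -> F i `<=` W) -> uniq s -> trivIset [set` s] F ->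
  (\sum_(i <- s) mu (F i) <= mu W)%E.
Proof.
move=> mF mW FW us tF.
have := @mint_sum_overlap I F W (cst 1%E) s 1 mF mW (measurable_cst _)
  (fun=> lee01) FW (fun z => count_trivIset z us tF).
rewrite mul1e mint_cst// mul1e; apply: le_trans.
by apply: lee_sum => i _; rewrite mint_cst// mul1e.
Qed.

Context (mu_doubling : doubling mu).

Lemma mu_ball_gt0 x r : 0 < r -> (0 < mu (ball x r))%E.
Proof.
move=> r0; have [Cd [_ /(_ x (r / 2))[]]] := mu_doubling; first by rewrite divr_gt0.
by rewrite mulrCA divff// mulr1.
Qed.

Lemma mu_ball_fin_num x r : mu (ball x r) \is a fin_num.
Proof.
have [r0|r0] := ltP 0 r; last first.
  rewrite (_ : ball x r = set0) ?outer_measure0//.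
  by apply/seteqP; split => // y; rewrite in_ball ltNge (le_trans r0)// mdist_ge0.
have [Cd [Cd1 /(_ x r r0)[_ _ h]]] := mu_doubling.
rewrite ge0_fin_numE ?outer_measure_ge0//; apply: le_lt_trans h.
by rewrite -[leLHS]mul1e lee_wpmul2r ?outer_measure_ge0// lee_fin.
Qed.

Lemma volE A x r : A `<=` ball x r -> (vol A)%:E = mu A.
Proof.
move=> Ax; rewrite fineK// ge0_fin_numE ?outer_measure_ge0//.
apply: (le_lt_trans (le_outer_measure mu _ _ Ax)).
by rewrite -ge0_fin_numE ?outer_measure_ge0// mu_ball_fin_num.
Qed.

Lemma vol_ballE x r : (vol (ball x r))%:E = mu (ball x r).
Proof.
exact: (@volE _ x r).
Qed.

Lemma vol_ball_gt0 x r : 0 < r -> 0 < vol (ball x r).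
Proof.
by move=> r0; rewrite -lte_fin vol_ballE mu_ball_gt0.
Qed.

Lemma le_vol A B x r : A `<=` B -> B `<=` ball x r -> vol A <= vol B.
Proof.
move=> AB Bx; rewrite -lee_fin (volE Bx) (volE (subset_trans AB Bx)).
exact: le_outer_measure.
Qed.

Lemma vol_split (E : set X) x r : mu.-caratheodory E ->
  vol (ball x r) = vol (ball x r `&` E) + vol (ball x r `&` ~` E).
Proof.
move=> mE; apply/EFin_inj; rewrite EFinD vol_ballE.
by rewrite (@volE _ x r) ?(@volE _ x r)//.
Qed.

(** Doubling, iterated: a ball [ball x s] contained in [ball y (K r)] has volume
    controlled by that of [ball y r]. *)
Lemma doubling_compare (K : R) : exists2 C : R, 1 <= C &
  forall x y (r s : R), 0 < r -> ball x s `<=` ball y (K * r) ->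
    vol (ball x s) <= C * vol (ball y r).
Proof.
have [Cd [Cd1 hC]] := mu_doubling.
have [n Kn] : exists n, K <= 2 ^+ n.
  exists (Num.truncn K).+1; apply: (le_trans (ltW (truncnS_gt K))).
  by rewrite -natrX ler_nat ltnW// ltn_expl.
exists (Cd ^+ n); first exact: exprn_ege1.
move=> x y r s r0 xy.
have {xy} : vol (ball x s) <= vol (ball y (2 ^+ n * r)).
  apply: (le_vol _ (@subset_refl _ _)); apply: (subset_trans xy).
  by apply: sub_ball; rewrite mdistxx add0r ler_wpM2r// ltW.
move/le_trans; apply => {x s Kn}.
elim: n => [|n IH]; first by rewrite !expr0 !mul1r.
rewrite exprS -mulrA exprS -mulrA; apply: (@le_trans _ _ (Cd * vol (ball y (2 ^+ n * r)))).
  rewrite -lee_fin EFinM !vol_ballE.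
  have [] := hC y (2 ^+ n * r); first by rewrite mulr_gt0// exprn_gt0.
  by [].
by rewrite ler_wpM2l// (le_trans ler01).
Qed.

(** In a doubling space, the number of [r]-separated points in a ball of radius
    [K r] is bounded independently of the ball and of [r]. *)
Lemma packing (K : R) : exists N : nat, forall y r (s : seq X), 0 < r ->
  separated r s -> [set` s] `<=` ball y (K * r) -> (size s <= N)%N.
Proof.
have [C C1 hC] := doubling_compare (4 * (`|K| + 1)).
exists (Num.truncn C); move=> y r s r0 ss sy.
have us := separated_uniq r0 ss.
have Kn := ler_norm K.
set W := ball y ((`|K| + 1) * r).
have W0 : 0 < vol W by rewrite vol_ball_gt0// mulr_gt0// ltr_wpDl.
have sW x : x \in s -> ball x (r / 2) `<=` W.
  move=> /sy; rewrite in_ball => yx; apply: sub_ball.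
  have : K * r <= `|K| * r by rewrite ler_wpM2r// ltW.
  lra.
have sum_le : \sum_(x <- s) vol (ball x (r / 2)) <= vol W.
  rewrite -lee_fin -sumEFin vol_ballE.
  apply: le_trans (sum_mu_disjoint _ _ sW us (separated_disjoint ss)).
  - by apply: lee_sum => x _; rewrite vol_ballE.
  - by move=> x; exact: ball_measurable.
  - exact: ball_measurable.
have : (size s)%:R * vol W <= C * vol W.
  apply: le_trans (ler_wpM2l (le_trans ler01 C1) sum_le).
  rewrite mulr_sumr -sum1_size natr_sum mulr_suml big_seq [leRHS]big_seq.
  apply: ler_sum => x xs; rewrite mul1r; apply: hC; first by rewrite divr_gt0.
  apply: sub_ball; move: (sy x xs); rewrite in_ball metric_sym => yx.
  have : K * r <= `|K| * r by rewrite ler_wpM2r// ltW.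
  have := mulr_ge0 (normr_ge0 K) (ltW r0).
  lra.
rewrite ler_pM2r// => sC; rewrite -(@ler_nat R).
by rewrite ler_nat -truncn_ge_nat ?(le_trans _ C1)// in sC *; rewrite ler_nat.
Qed.

(** The balls of radius [K r] centred at [r]-separated points have bounded
    overlap. *)
Lemma overlap_bound (K : R) : exists N : nat, forall y r (s : seq X), 0 < r ->
  separated r s -> (count (fun x => y \in (ball x (K * r) : set X)) s <= N)%N.
Proof.
have [N hN] := packing K; exists N => y r s r0 ss.
rewrite -size_filter; apply: (hN y r) => //.
  exact: pairwise_filter.
by move=> x /=; rewrite mem_filter => /andP[/set_mem]; rewrite !in_ball metric_sym.
Qed.

(** Bounded sets are totally bounded: they have finite [r]-nets. *)
Lemma bounded_net A x0 (r0 r : R) : 0 < r -> A `<=` ball x0 r0 ->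
  exists s, [/\ separated r s, [set` s] `<=` A &
    forall x, A x -> exists2 y, y \in s & mdist y x < r].
Proof.
move=> r_gt0 Ax0; have [N hN] := packing (r0 / r).
apply: (@exists_net _ _ r A N) => s ss sA; apply: (hN x0 r) => //.
by rewrite divfK ?gt_eqF//; exact: (subset_trans sA).
Qed.

End doubling.

(** * The relative isoperimetric inequality *)

Section isoperimetric.
Context {R : realType} {X : completeMetricType R}.
Context (mu : {outer_measure set X -> \bar R}).
Implicit Types (x y z : X) (r : R) (A B E : set X) (u : X -> R) (g : X -> \bar R).

Local Notation T := (caratheodory_type mu).
Local Notation m := (mu : set T -> \bar R).
Local Open Scope ereal_scope.

(** The measure of the smaller of the two pieces into which [E] cuts a ball. *)
Definition mixed E x r : R :=
  Num.min (vol mu (ball x r `&` E)) (vol mu (ball x r `&` ~` E)).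

(** The L1 distance on [A] between [u] and the characteristic function of [E]. *)
Definition L1dist E A u : \bar R :=
  mint mu A (fun y => `|(u y)%:E - (\1_E y)%:E|).

(** The (1,1)-Poincare inequality with given constants. *)
Definition poincare_with (CP lam : R) : Prop :=
  forall x r (u : X -> \bar R) g, (0 < r)%R ->
    L1_loc mu u -> upper_gradient u g ->
    avg mu (ball x r) (fun y => `|u y - avg mu (ball x r) u|) <=
    (CP * r)%:E * avg mu (ball x (lam * r)%R) g.

Lemma mixed_ge0 E x r : (0 <= mixed E x r)%R.
Proof.
by rewrite /mixed le_min !vol_ge0.
Qed.

Lemma mint_ge0 A g : (forall y, 0 <= g y) -> 0 <= mint mu A g.
Proof.
by move=> g0; apply: integral_ge0.
Qed.

Context (mu_regular : borel_regular mu) (mu_doubling : doubling mu).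

Lemma borel_fun_measurable g : nonneg_borel_fun g ->
  measurable_fun setT (g : T -> \bar R).
Proof.
move=> [mg _] _ Y mY; rewrite setTI.
apply: (borel_measurable mu_regular).
by have := mg measurableT Y mY; rewrite setTI.
Qed.

Lemma continuous_fun_measurable u : continuous u ->
  measurable_fun setT (u : T -> R).
Proof.
move=> cu; apply: (@measurability _ _ T R _ _ _ (RGenOInfty.measurableE R)).
move=> _ [_ [a ->] <-]; rewrite setTI.
apply: (open_measurable mu_regular).
by apply: (proj1 (continuousP u) cu); exact: interval_open.
Qed.

Lemma locally_lipschitz_continuous u : locally_lipschitz u -> continuous u.
Proof.
move=> lu x; have [r r0 [L hL]] := lu x.
apply/cvgrPdist_lt => e e0; near=> y.
have xy : ball x r y by near: y; exact: nbhsx_ballx.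
have xye : (mdist x y < e / (`|L| + 1))%R.
  rewrite -in_ball; near: y; apply: nbhsx_ballx.
  by rewrite divr_gt0// ltr_wpDl.
apply: le_lt_trans (hL x y (ballxx _ r0) xy) _.
rewrite ltr_pdivlMr in xye; last by rewrite ltr_wpDl.
apply: le_lt_trans xye; rewrite mulrC ler_wpM2l ?mdist_ge0//.
by apply: (le_trans (ler_norm L)); rewrite lerDl.
Unshelve. all: by end_near. Qed.

Lemma locally_lipschitz_measurable u : locally_lipschitz u ->
  measurable_fun setT (u : T -> R).
Proof.
by move=> lu; apply: continuous_fun_measurable; exact: locally_lipschitz_continuous.
Qed.

Lemma locally_lipschitz_L1_loc u : locally_lipschitz u -> L1_loc mu (EFin \o u).
Proof.
move=> lu x; have [r r0 [L hL]] := lu x; exists r => //.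
apply: measurable_bounded_integrable.
- exact: ball_measurable.
- by rewrite -ge0_fin_numE ?outer_measure_ge0//; exact: mu_ball_fin_num.
- by apply: measurable_funTS; exact: locally_lipschitz_measurable.
exists (`|u x| + `|L| * r)%R; split; first exact: num_real.
move=> b hb y /= xy; apply: le_trans (ltW hb).
have := hL y x xy (ballxx _ r0).
have : (L * mdist y x <= `|L| * r)%R.
  apply: (@le_trans _ _ (`|L| * mdist y x)%R).
    by rewrite ler_wpM2r ?mdist_ge0// ler_norm.
  by rewrite ler_wpM2l// metric_sym ltW// -in_ball.
have := ler_distD (u x) (u y) 0%R; rewrite !subr0 /=; lra.
Qed.

Context (E : set X) (mE : mu.-caratheodory E).

Let mE' : measurable (E : set T). Proof. exact: mE. Qed.

Lemma chi_measurable D : measurable_fun D (\1_E : T -> R).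
Proof.
exact: measurable_indic.
Qed.

(** For every constant [a], the L1 distance of the characteristic function of
    [E] from [a] on a ball controls the smaller of the two pieces of the ball. *)
Lemma mixed_le_dist_cst x r (a : R) :
  (mixed E x r)%:E <= mint mu (ball x r) (fun y => `|(\1_E y)%:E - a%:E|).
Proof.
have mB := ball_measurable mu_regular x r.
have mBE : measurable (ball x r `&` E : set T) by exact: measurableI.
have mBC : measurable (ball x r `&` ~` E : set T).
  by apply: measurableI => //; exact: measurableC.
have -> : mint mu (ball x r) (fun y => `|(\1_E y)%:E - a%:E|) =
    mint mu (ball x r `&` E) (fun y => `|(\1_E y)%:E - a%:E|) +
    mint mu (ball x r `&` ~` E) (fun y => `|(\1_E y)%:E - a%:E|).
  rewrite /mint -ge0_integral_setU//.
  - by rewrite -setIUr setUv setIT.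
  - apply/measurable_EFinP; apply: measurableT_comp => //.
    by apply: measurable_funB => //; exact: chi_measurable.
  - by apply/disj_setPS => y [[_ ?] [_]].
have -> : mint mu (ball x r `&` E) (fun y => `|(\1_E y)%:E - a%:E|) =
    mint mu (ball x r `&` E) (cst `|1 - a|%:E).
  apply: eq_integral => y /set_mem[_ Ey].
  by rewrite indicE mem_set// -EFinB abse_EFin.
have -> : mint mu (ball x r `&` ~` E) (fun y => `|(\1_E y)%:E - a%:E|) =
    mint mu (ball x r `&` ~` E) (cst `|a|%:E).
  apply: eq_integral => y /set_mem[_ Ey].
  by rewrite indicE memNset// -EFinB abse_EFin sub0r normrN.
rewrite !mint_cst// -!(@volE _ _ mu mu_doubling _ x r)// -!EFinM -EFinD lee_fin.
set e := vol _ _; set c := vol _ _.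
have e0 : (0 <= e)%R := vol_ge0 _ _.
have c0 : (0 <= c)%R := vol_ge0 _ _.
have m0 := mixed_ge0 E x r.
have me : (mixed E x r <= e)%R by rewrite /mixed ge_min lexx.
have mc : (mixed E x r <= c)%R by rewrite /mixed ge_min lexx orbT.
have h1 := ler_distD a 1%R 0%R; rewrite !subr0 normr1 in h1.
have := ler_wpM2l (normr_ge0 (1 - a)%R) me.
have := ler_wpM2l (normr_ge0 a) mc.
have := ler_wpM2r m0 h1.
lra.
Qed.

Context (CP lam : R) (CP0 : (0 < CP)%R) (lam1 : (1 <= lam)%R)
  (PI : poincare_with CP lam).

(** The relative isoperimetric inequality for a function [u] that approximates
    the characteristic function of [E]. *)
Lemma isoperimetric u g x r : (0 < r)%R ->
  measurable_fun setT (u : T -> R) -> L1_loc mu (EFin \o u) ->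
  upper_gradient (EFin \o u) g ->
  (mixed E x r)%:E <=
  L1dist E (ball x r) u + (CP * r)%:E * mint mu (ball x (lam * r)) g.
Proof.
move=> r0 mu_u uL1 ug.
have [bg g0] := ug.1.
have G0 : 0 <= mint mu (ball x (lam * r)) g by exact: mint_ge0.
have CPr : (0 < CP * r)%R by rewrite mulr_gt0.
(* If [u] is at infinite L1 distance from the characteristic function, the
   right-hand side is infinite; otherwise [u] is integrable on the ball. *)
have [->|Ify] := eqVneq (L1dist E (ball x r) u) +oo.
  rewrite addye ?leey//.
  have : 0 <= (CP * r)%:E * mint mu (ball x (lam * r)) g.
    by rewrite mule_ge0// lee_fin ltW.
  by case: (_ * _).
set I := L1dist _ _ _ in Ify *.
have mB := ball_measurable mu_regular x r.
have mdist1 : measurable_fun (ball x r : set T) (fun y : T => `|(u y)%:E - (\1_E y)%:E|).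
  apply/measurable_EFinP; apply: measurableT_comp => //.
  apply: measurable_funB; first exact: measurable_funTS.
  exact: chi_measurable.
have mu_u' : measurable_fun (ball x r : set T) (EFin \o (u : T -> R)).
  by apply/measurable_EFinP; exact: measurable_funTS.
have muBy : mu (ball x r) < +oo.
  by rewrite -ge0_fin_numE ?outer_measure_ge0//; exact: mu_ball_fin_num.
have intu : m.-integrable (ball x r) (EFin \o (u : T -> R)).
  apply/integrableP; split => //.
  apply: (@le_lt_trans _ _
    (\int[m]_(y in ball x r) (`|(u y)%:E - (\1_E y)%:E| + cst 1 y))).
    apply: ge0_le_integral => //.
    - exact: measurableT_comp.
    - exact: emeasurable_funD.
    - move=> y _; rewrite -EFinB /= lee_fin.
      have := ler_distD (\1_E y) (u y) 0%R; rewrite !subr0.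
      have : (`|\1_E y : R| <= 1)%R.
        by rewrite indicE; case: (_ \in _); rewrite ?normr1 ?normr0.
      lra.
  rewrite ge0_integralD// lte_add_pinfty//; first by rewrite ltey.
  by rewrite integral_cst// mul1e.
have Jfin : mint mu (ball x r) (EFin \o u) \is a fin_num := integrable_fin_num mB intu.
set b := vol mu (ball x r); set L := vol mu (ball x (lam * r)%R).
have b0 : (0 < b)%R by exact: vol_ball_gt0.
have bL : (b <= L)%R.
  apply: le_vol (@subset_refl _ _) => //.
  by apply: sub_ball; rewrite mdistxx add0r ler_peMl// ltW.
have L0 : (0 < L)%R := lt_le_trans b0 bL.
have bE : (mu (ball x r))^-1 = (b^-1)%:E by rewrite -vol_ballE// inver gt_eqF.
have LE : (mu (ball x (lam * r)%R))^-1 = (L^-1)%:E by rewrite -vol_ballE// inver gt_eqF.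
have := @PI x r (EFin \o u) g r0 uL1 ug.
have [a ->] : exists a, avg mu (ball x r) (EFin \o u) = a%:E.
  exists (fine (avg mu (ball x r) (EFin \o u))); rewrite fineK//.
  by rewrite /avg bE fin_numM.
rewrite /avg bE LE lee_pdivrMl// => PIu.
apply: (le_trans (mixed_le_dist_cst x r a)).
apply: (@le_trans _ _ (I + mint mu (ball x r) (fun y => `|(EFin \o u) y - a%:E|))).
  rewrite /I /L1dist /mint -ge0_integralD//.
    apply: ge0_le_integral => //.
    - apply/measurable_EFinP; apply: measurableT_comp => //.
      by apply: measurable_funB => //; exact: chi_measurable.
    - apply: emeasurable_funD => //.
      apply: measurableT_comp => //; apply: emeasurable_funB => //.
    - move=> y _; rewrite /= lee_fin.
      by have := ler_distD (u y) (\1_E y) a; rewrite (distrC (\1_E y) (u y)).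
  by apply: measurableT_comp => //; apply: emeasurable_funB => //.
rewrite leeD2l//; apply: (le_trans PIu).
rewrite muleCA muleA -EFinM muleA -EFinM lee_wpmul2r// lee_fin.
rewrite -mulrA ger_pMr// ler_pdivrMr// mul1r.
exact: bL.
Qed.

End isoperimetric.

(** * Approximating sequences and their energies *)

Section approximation.
Context {R : realType} {X : completeMetricType R}.
Context (mu : {outer_measure set X -> \bar R}).
Implicit Types (x y z : X) (r : R) (A B D E : set X).

Local Notation T := (caratheodory_type mu).
Local Notation m := (mu : set T -> \bar R).

(** A sequence witnessing finite perimeter: the [v i] converge locally in L1 to
    the characteristic function of [E], and the integrals of their upper
    gradients [g i] are bounded by [M]. *)
Definition approximation E (v : nat -> X -> R) (g : nat -> X -> \bar R) (M : R) :=
  [/\ forall i, locally_lipschitz (v i),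
      cvg_L1_loc mu v (EFin \o \1_E),
      forall i, upper_gradient (EFin \o v i) (g i) &
      forall i, (mint mu setT (g i) <= M%:E)%E].

Lemma limn_einf_frequently (w : nat -> \bar R) (M : R) :
  (limn_einf w < M%:E)%E -> forall n, exists2 i, (n <= i)%N & (w i <= M%:E)%E.
Proof.
move=> wM n; apply: contrapT => hn; move: wM; rewrite ltNge => /negP; apply.
rewrite /limn_einf /limn_esup -/(limf_einf w \oo) limf_einfE.
apply: ereal_sup_ge; exists (ereal_inf (w @` [set i | (n <= i)%N])).
  by exists [set i | (n <= i)%N] => //; exists n.
apply: le_ereal_inf_tmp => _ [i /= ni <-].
by rewrite leNgt; apply/negP => /ltW wi; apply: hn; exists i.
Qed.

(** The lower limit in the definition of the total variation is finite, so a
    subsequence has bounded integrals. *)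
Lemma finite_perimeter_approximation E : finite_perimeter mu E ->
  exists v g M, approximation E v g M.
Proof.
move=> [_ /ereal_inf_lt[_ [v [g [lv cv ug ->]]] gy]].
have [M hM] : exists M : R, (limn_einf (fun i => mint mu setT (g i)) < M%:E)%E.
  move: gy; case: (limn_einf _) => [a _| //|_].
  - by exists (a + 1); rewrite lte_fin ltrDl.
  - by exists 0; rewrite ltNyr.
have /choice[phi hphi] : forall n, exists i, (n <= i)%N /\ (mint mu setT (g i) <= M%:E)%E.
  by move=> n; have [i ? ?] := limn_einf_frequently hM n; exists i.
exists (v \o phi), (g \o phi), M; split => //.
- by move=> i; exact: lv.
- move=> x; have [r r0 hr] := cv x; exists r => //.
  apply: (cvg_comp _ _ _ hr).
  by apply/cvgnyPge => n; exists n => // k /= nk; apply: (leq_trans nk); have [] := hphi k.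
- by move=> i; exact: ug.
- by move=> i; have [] := hphi i.
Qed.

(** For uniformly bounded functions [F i] of a scale, some scale [s0] is such
    that, whatever the smaller scale [s], the increment of [F i] from [s] to [s0]
    is at most [eta] for infinitely many [i]. *)
Lemma pigeonhole_scale (F : nat -> R -> R) (M eta s1 : R) :
  (forall i s, 0 <= F i s <= M) -> 0 < eta -> 0 < s1 ->
  exists s0, [/\ 0 < s0, s0 <= s1 & forall s, 0 < s -> s < s0 ->
    forall n, exists2 i, (n <= i)%N & F i s0 <= F i s + eta].
Proof.
move=> FM eta0 s10; apply: contrapT => no.
have step s0 : 0 < s0 -> s0 <= s1 -> exists s, [/\ 0 < s, s <= s0 &
    exists n, forall i, (n <= i)%N -> F i s + eta <= F i s0].
  move=> s00 s01; apply: contrapT => hs; apply: no; exists s0; split => //.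
  move=> s sgt slt n; apply: contrapT => hn; apply: hs.
  exists s; split => //; first exact: ltW.
  exists n => i ni; rewrite leNgt; apply/negP => /ltW Fi; apply: hn.
  by exists i.
(* If no scale works, [F i] eventually increases by at least [eta] over each of
   arbitrarily many consecutive ranges of scales, contradicting the bound [M]. *)
have chain k : exists s, [/\ 0 < s, s <= s1 &
    exists n, forall i, (n <= i)%N -> F i s + k%:R * eta <= F i s1].
  elim: k => [|k [s [sgt ss1 [n hn]]]].
    by exists s1; split => //; exists 0%N => i _; rewrite mul0r addr0.
  have [s' [s'gt s's [n' hn']]] := step s sgt ss1.
  exists s'; split => //; first exact: le_trans ss1.
  exists (maxn n n') => i; rewrite geq_max => /andP[/hn hi /hn' hi'].
  by rewrite -natr1 mulrDl mul1r; lra.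
have [s [_ _ [n /(_ n (leqnn n))]]] := chain (Num.truncn (M / eta)).+1.
have := truncnS_gt (M / eta); rewrite ltr_pdivrMr//.
have := FM n s; have := FM n s1; lra.
Qed.

Context (mu_regular : borel_regular mu) (mu_doubling : doubling mu).

Lemma nonneg_borel_le_mint (g : X -> \bar R) A B : nonneg_borel_fun g ->
  measurable (A : set T) -> measurable (B : set T) -> A `<=` B ->
  (mint mu A g <= mint mu B g)%E.
Proof.
move=> bg mA mB AB; apply: ge0_subset_integral => //.
  by apply: measurable_funTS; exact: borel_fun_measurable.
by move=> x _; exact: bg.2.
Qed.

(** Integrals of nonnegative functions are subadditive over finite covers. *)
Lemma mint_cover (I : eqType) (F : I -> set X) A (f : X -> \bar R) (s : seq I) :
  (forall i, measurable (F i : set T)) -> measurable (A : set T) ->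
  measurable_fun setT (f : T -> \bar R) -> (forall y, 0 <= f y)%E ->
  (forall y, A y -> exists2 i, i \in s & F i y) ->
  (mint mu A f <= \sum_(i <- s) mint mu (F i) f)%E.
Proof.
move=> mF mA mf f0 AF.
have mp (B : set T) : measurable B -> measurable_fun setT (f \_ B : T -> \bar R).
  by move=> mB; apply/(measurable_restrictT _ mB); exact: measurable_funTS.
have p0 (B : set T) y : (0 <= (f \_ B) y)%E by rewrite /patch; case: ifP.
rewrite /mint integral_mkcond; under eq_bigr do rewrite integral_mkcond.
rewrite -ge0_integral_sum//; last by move=> i; exact: mp.
apply: ge0_le_integral => //.
- exact: mp.
- by apply: emeasurable_sum => i; exact: mp.
move=> y _; rewrite (@sum_patch _ T R I F f s y f0) {1}/patch; case: ifPn => yA.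
  rewrite -[leLHS]mul1e lee_wpmul2r// lee_fin ler1n -has_count; apply/hasP.
  by have [i si Fi] := AF y (set_mem yA); exists i => //; rewrite inE.
by rewrite mule_ge0// lee_fin.
Qed.

Context (E : set X) (mE : mu.-caratheodory E).
Context (CP lam : R) (CP0 : 0 < CP) (lam1 : 1 <= lam)
  (PI : poincare_with mu CP lam).
Context (v : nat -> X -> R) (g : nat -> X -> \bar R) (M : R)
  (vg : approximation E v g M).

(** The integral over [A] of the upper gradient [g i], as a real number. *)
Definition energy i A : R := fine (mint mu A (g i)).

(** The approximating sequence [v] converges in L1 on [A]. *)
Definition L1cvg_on A : Prop := forall delta : R, 0 < delta ->
  exists n0, forall i, (n0 <= i)%N -> (L1dist mu E A (v i) <= delta%:E)%E.

Let g_borel i : nonneg_borel_fun (g i).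
Proof.
by have [_ _ /(_ i)[]] := vg.
Qed.

Lemma energyE i A : measurable (A : set T) -> (energy i A)%:E = mint mu A (g i).
Proof.
move=> mA; rewrite fineK// ge0_fin_numE; last first.
  by apply: mint_ge0 => y; exact: (g_borel i).2.
have [_ _ _ /(_ i) gM] := vg.
by apply: le_lt_trans (ltry M); apply: le_trans gM; exact: nonneg_borel_le_mint.
Qed.

Lemma energy_ge0 i A : 0 <= energy i A.
Proof.
by apply: fine_ge0; apply: mint_ge0 => y; exact: (g_borel i).2.
Qed.

Lemma energy_le i A B : measurable (A : set T) -> measurable (B : set T) ->
  A `<=` B -> energy i A <= energy i B.
Proof.
by move=> mA mB AB; rewrite -lee_fin !energyE//; exact: nonneg_borel_le_mint.
Qed.

Lemma energy_leM i A : measurable (A : set T) -> energy i A <= M.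
Proof.
move=> mA; apply: (@le_trans _ _ (energy i setT)); first exact: energy_le.
by rewrite -lee_fin energyE//; have [_ _ _] := vg.
Qed.

Lemma energyD i A B : measurable (A : set T) -> measurable (B : set T) ->
  B `<=` A -> energy i (A `\` B) = energy i A - energy i B.
Proof.
move=> mA mB BA; apply/eqP; rewrite eq_sym subr_eq; apply/eqP/EFin_inj.
have mAB : measurable (A `\` B : set T) by exact: measurableD.
rewrite EFinD !energyE// /mint -ge0_integral_setU//.
- by rewrite setUC setDUK.
- by apply: measurable_funTS; exact: borel_fun_measurable.
- by move=> x _; exact: (g_borel i).2.
- by apply/disj_setPS => y [[_ ?] ?].
Qed.

Lemma L1cvg_onS A B : measurable (A : set T) -> measurable (B : set T) ->
  A `<=` B -> L1cvg_on B -> L1cvg_on A.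
Proof.
move=> mA mB AB hB delta /hB[n0 hn0]; exists n0 => i /hn0; apply: le_trans.
apply: ge0_subset_integral => //.
have [/(_ i) lv _ _ _] := vg.
apply/measurable_EFinP; apply: measurableT_comp => //.
apply: measurable_funB; last exact: chi_measurable.
by apply: measurable_funTS; exact: locally_lipschitz_measurable.
Qed.

Lemma L1cvg_loc x : exists2 r : R, 0 < r & L1cvg_on (ball x r).
Proof.
have [_ /(_ x)[r r0 cvgr] _ _] := vg; exists r => // delta delta0.
have /fine_cvgP[[n1 _ fin] /cvgrPdist_le/(_ _ delta0)[n2 _ hn]] := cvgr.
exists (maxn n1 n2) => i; rewrite geq_max => /andP[/fin fi /hn].
rewrite /= sub0r normrN => hi; rewrite /L1dist.
by rewrite -(fineK fi) lee_fin; apply: le_trans hi; exact: ler_norm.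
Qed.

(** The isoperimetric inequality, summed over a finite family of balls and
    passed to the limit along the approximating sequence. *)
Lemma sum_isoperimetric (s : seq X) (rad : X -> R) (N : nat) (G : set X) (delta : R) :
  (forall x, x \in s -> 0 < rad x) ->
  (forall x, x \in s -> L1cvg_on (ball x (rad x))) ->
  (forall x, x \in s -> ball x (lam * rad x) `<=` G) ->
  measurable (G : set T) ->
  (forall y, (count (fun x => y \in (ball x (lam * rad x) : set X)) s <= N)%N) ->
  0 < delta ->
  exists n0, forall i, (n0 <= i)%N ->
    \sum_(x <- s) mixed mu E x (rad x) / rad x <= delta + CP * (N%:R * energy i G).
Proof.
move=> rad0 cvgs sG mG overlap delta0.
have main (t : seq X) (e : R) : 0 < e -> {subset t <= s} -> exists n0, forall i, (n0 <= i)%N ->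
    \sum_(x <- t) mixed mu E x (rad x) / rad x <=
    e + CP * \sum_(x <- t) energy i (ball x (lam * rad x)).
  elim: t e => [|x t IH] e e0 ts.
    by exists 0%N => i _; rewrite !big_nil mulr0 addr0 ltW.
  have xs : x \in s by apply: ts; rewrite mem_head.
  have e20 : 0 < e / 2 by rewrite divr_gt0.
  have [|n1 hn1] := IH (e / 2) e20.
    by move=> y yt; apply: ts; rewrite inE yt orbT.
  have [n2 hn2] := cvgs x xs (e / 2 * rad x) (mulr_gt0 e20 (rad0 x xs)).
  exists (maxn n1 n2) => i; rewrite geq_max => /andP[/hn1 hi1 /hn2 hi2].
  rewrite !big_cons.
  suff : mixed mu E x (rad x) / rad x <= e / 2 + CP * energy i (ball x (lam * rad x)).
    lra.
  rewrite ler_pdivrMr ?rad0// mulrDl -lee_fin EFinD.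
  have [/(_ i) lv _ /(_ i) ugi _] := vg.
  apply: (le_trans (isoperimetric mu_regular mu_doubling mE CP0 lam1 PI x (rad0 x xs)
    (locally_lipschitz_measurable mu_regular lv)
    (locally_lipschitz_L1_loc mu_regular mu_doubling lv) ugi)).
  apply: leeD => //; rewrite -energyE; last exact: ball_measurable.
  by rewrite -EFinM lee_fin mulrAC.
have [n0 hn0] := main s delta delta0 (fun _ h => h).
exists n0 => i /hn0/le_trans; apply.
rewrite lerD2l ler_pM2l// -lee_fin -sumEFin EFinM energyE//.
have -> : (\sum_(x <- s) (energy i (ball x (lam * rad x)))%:E =
    \sum_(x <- s) mint mu (ball x (lam * rad x)) (g i))%E.
  by apply: eq_bigr => x _; rewrite energyE//; exact: ball_measurable.
apply: mint_sum_overlap => //.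
- by move=> x; exact: ball_measurable.
- exact: borel_fun_measurable.
- by move=> y; exact: (g_borel i).2.
Qed.

End approximation.

(** * Lipschitz approximation at a fixed scale *)

Section plateau.
Context {R : realType} {X : completeMetricType R}.
Context (mu : {outer_measure set X -> \bar R}).
Implicit Types (x y z : X) (r s : R) (A B D E : set X).

Local Notation T := (caratheodory_type mu).
Local Notation m := (mu : set T -> \bar R).

(** The open [s]-neighbourhood of [D]. *)
Definition thickening D s : set X := \bigcup_(x in D) ball x s.

Lemma thickening_open D s : open (thickening D s).
Proof.
by apply: bigcup_open => x _; exact: open_ball.
Qed.

Lemma thickeningS D s r : s <= r -> thickening D s `<=` thickening D r.
Proof.
by move=> sr y [x Dx xy]; exists x => //; apply: sub_ball xy; rewrite mdistxx add0r.
Qed.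

Lemma thickening_ball D x y s r : thickening D s x -> mdist x y < r ->
  thickening D (s + r) y.
Proof.
move=> [d Dd]; rewrite in_ball => dx xy; exists d => //; rewrite in_ball.
by have := metric_triangle d x y; lra.
Qed.

Context (mu_regular : borel_regular mu) (mu_doubling : doubling mu).
Context (E : set X) (mE : mu.-caratheodory E).
Context (C4 : R) (C41 : 1 <= C4)
  (hC4 : forall x y r s, 0 < r -> ball x s `<=` ball y (4 * r) ->
    vol mu (ball x s) <= C4 * vol mu (ball y r)).

Let mE' : measurable (E : set T). Proof. exact: mE. Qed.

Let theta := (4 * C4)^-1.

Let theta_gt0 : 0 < theta.
Proof.
by rewrite invr_gt0 mulr_gt0// (lt_le_trans ltr01).
Qed.

Let C4_gt0 : 0 < C4. Proof. exact: lt_le_trans C41. Qed.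

Let thetaC4 : theta * C4 = 4^-1.
Proof.
by rewrite /theta invfM -mulrA mulVf ?mulr1// gt_eqF.
Qed.

(** The points around which [E] fills at least three quarters of the ball of
    radius [r]. *)
Definition full_at r : set X :=
  [set x | vol mu (ball x r `&` ~` E) <= 4^-1 * vol mu (ball x r)].

(** A Lipschitz approximation at scale [r] of the characteristic function of [E]:
    it is 1 at the points around which [E] nearly fills the ball of radius [r],
    and 0 at the points at distance at least [r / 2] from all of these. *)
Definition plateau r : X -> R := tent (full_at r) (2 / r).

(** The centres of mixed balls of radius [2 r]. *)
Definition mixed_at r : set X :=
  [set x | theta * vol mu (ball x (2 * r)) <= mixed mu E x (2 * r)].

(** The open set outside which [plateau r] is locally constant. *)
Definition transition r : set X := thickening (mixed_at r) r.

(** Around a point whose ball of radius [2 r] is not mixed, [plateau r] is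
    constant, with the value of the characteristic function of [E] on the
    larger piece of that ball. *)
Lemma plateau_dichotomy x r : 0 < r ->
  mixed mu E x (2 * r) < theta * vol mu (ball x (2 * r)) ->
  (vol mu (ball x (2 * r) `&` ~` E) <= mixed mu E x (2 * r) /\
    forall y, ball x (r / 2) y -> plateau r y = 1) \/
  (vol mu (ball x (2 * r) `&` E) <= mixed mu E x (2 * r) /\
    forall y, ball x (r / 2) y -> plateau r y = 0).
Proof.
move=> r0 mlt.
have K0 : 0 <= 2 / r by rewrite divr_ge0// ltW.
have small A h : mdist x h <= r ->
    vol mu (ball x (2 * r) `&` A) <= mixed mu E x (2 * r) ->
    vol mu (ball h r `&` A) < 4^-1 * vol mu (ball h r).
  move=> xh Am.
  have hx : ball h r `<=` ball x (2 * r) by apply: sub_ball; lra.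
  have : vol mu (ball h r `&` A) <= vol mu (ball x (2 * r) `&` A).
    by apply: (le_vol mu_doubling (x := x) (r := 2 * r)) => //; exact: setSI.
  have : vol mu (ball x (2 * r)) <= C4 * vol mu (ball h r).
    by apply: hC4 => //; apply: sub_ball; rewrite metric_sym; lra.
  by rewrite -(ler_pM2l theta_gt0) mulrA thetaC4; lra.
have [inout|/ltW outin] := leP (vol mu (ball x (2 * r) `&` E)) (vol mu (ball x (2 * r) `&` ~` E)).
- have mm : vol mu (ball x (2 * r) `&` E) <= mixed mu E x (2 * r).
    by rewrite /mixed le_min lexx.
  right; split => // y; rewrite in_ball => xy.
  apply: tent_eq0 => // h /= hfull; rewrite leNgt; apply/negP => yh.
  have {}yh : mdist y h < r / 2.
    by move: yh; rewrite mulrAC ltr_pdivrMr// mul1r; lra.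
  have := metric_triangle x y h => tri.
  have := small E h (ltac:(lra)) mm.
  have := vol_split mu_doubling h r mE.
  have := vol_ball_gt0 mu_doubling h r0.
  have : vol mu (ball h r `&` ~` E) <= 4^-1 * vol mu (ball h r) := hfull.
  lra.
- have mm : vol mu (ball x (2 * r) `&` ~` E) <= mixed mu E x (2 * r).
    by rewrite /mixed le_min lexx andbT.
  left; split => // y; rewrite in_ball => xy.
  by apply: tent_eq1 => //=; apply/ltW/small => //; lra.
Qed.

Lemma plateau_lip r x y : 0 < r ->
  `|plateau r x - plateau r y| <= 2 / r * mdist x y.
Proof.
by move=> r0; apply: tent_lip; rewrite divr_ge0// ltW.
Qed.

Lemma plateau_locally_lipschitz r : 0 < r -> locally_lipschitz (plateau r).
Proof.
by move=> r0 x; exists 1 => //; exists (2 / r) => y z _ _; exact: plateau_lip.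
Qed.

Lemma transition_measurable r : measurable (transition r : set T).
Proof.
by apply: (open_measurable mu_regular); exact: thickening_open.
Qed.

Lemma plateau_upper_gradient r : 0 < r ->
  upper_gradient (EFin \o plateau r) (fun x => (2 / r * \1_(transition r) x)%:E).
Proof.
move=> r0; apply: (@upper_gradient_lip _ _ _ _ (r / 2)).
- by rewrite divr_ge0// ltW.
- by rewrite divr_gt0.
- by apply: sub_sigma_algebra; exact: thickening_open.
- by move=> x y; exact: plateau_lip.
move=> x xZ y xy.
have : mixed mu E x (2 * r) < theta * vol mu (ball x (2 * r)).
  by rewrite ltNge; apply/negP => xm; apply: xZ; exists x => //; exact: ballxx.
have xx : ball x (r / 2) x by apply: ballxx; rewrite divr_gt0.
by case/(plateau_dichotomy r0) => -[_ pl]; rewrite !pl.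
Qed.

Lemma mint_transition r A : 0 < r -> measurable (A : set T) ->
  mint mu A (fun x => (2 / r * \1_(transition r) x)%:E) =
  ((2 / r)%:E * mu (A `&` transition r))%E.
Proof.
move=> r0 mA; have mt := transition_measurable r.
rewrite setIC -(integral_indic m mA mt) /mint -ge0_integralZl//.
- by apply/measurable_EFinP; exact: measurable_indic.
- by rewrite lee_fin divr_ge0// ltW.
Qed.

Let plateau_measurable r : 0 < r -> measurable_fun setT (plateau r : T -> R).
Proof.
move=> r0; apply: (locally_lipschitz_measurable mu_regular).
exact: plateau_locally_lipschitz.
Qed.

(** If the ball of radius [2 r] is mixed, its whole measure is comparable with
    that of its smaller piece; otherwise [plateau r] is constant on the ball of
    radius [r / 2] and differs from the characteristic function only on the
    smaller piece. *)
Lemma L1dist_plateau_ball x r : 0 < r ->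
  (L1dist mu E (ball x (r / 2)) (plateau r) <=
   (theta^-1 * mixed mu E x (2 * r))%:E)%E.
Proof.
move=> r0.
have K0 : 0 <= 2 / r by rewrite divr_ge0// ltW.
have mB := ball_measurable mu_regular x (r / 2).
have sub : ball x (r / 2) `<=` ball x (2 * r) by apply: sub_ball; rewrite mdistxx; lra.
have m0 := mixed_ge0 mu E x (2 * r).
have th1 : 1 <= theta^-1 by rewrite /theta invrK; move: C41; lra.
have md D : measurable_fun (D : set T)
    (fun y : T => `|(plateau r y)%:E - (\1_E y)%:E|%E).
  apply/measurable_EFinP; apply: measurableT_comp => //.
  by apply: measurable_funB; [apply: measurable_funTS; exact: plateau_measurable
    |exact: chi_measurable].
have [mlt|mge] := ltP (mixed mu E x (2 * r)) (theta * vol mu (ball x (2 * r))); last first.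
  apply: (@le_trans _ _ (mu (ball x (r / 2)))).
    rewrite -[leRHS]mul1e -(mint_cst 1%E mB); apply: ge0_le_integral => //.
    move=> y _ /=; rewrite lee_fin.
    have := tent_ge0 (full_at r) K0 y; have := tent_le1 (full_at r) K0 y.
    by rewrite -/(plateau r y) indicE; case: (_ \in _); rewrite /= ler_norml; lra.
  rewrite -(vol_ballE mu_doubling) lee_fin ler_pdivlMl//.
  apply: le_trans mge; rewrite ler_pM2l//.
  exact: (le_vol mu_doubling sub (@subset_refl _ _)).
have key A : measurable (A : set T) ->
    vol mu (ball x (2 * r) `&` A) <= mixed mu E x (2 * r) ->
    (forall y, ball x (r / 2) y -> `|plateau r y - \1_E y| = \1_A y) ->
    (L1dist mu E (ball x (r / 2)) (plateau r) <= (theta^-1 * mixed mu E x (2 * r))%:E)%E.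
  move=> mA Am hA.
  have -> : L1dist mu E (ball x (r / 2)) (plateau r) = mu (A `&` ball x (r / 2)).
    rewrite -(integral_indic m mB mA); apply: eq_integral => y /set_mem xy.
    by rewrite -EFinB abse_EFin hA.
  rewrite -(@volE _ _ mu mu_doubling _ x (2 * r)); last by move=> y [_ /sub].
  rewrite lee_fin; apply: (@le_trans _ _ (mixed mu E x (2 * r))); last by rewrite ler_peMl.
  apply: le_trans Am; apply: (le_vol mu_doubling (x := x) (r := 2 * r)) => //.
  by move=> y [Ay /sub].
case: (plateau_dichotomy r0 mlt) => -[volm pl].
- apply: (key (~` E)) => //; first exact: measurableC.
  move=> y /pl ->; rewrite !indicE; case: (boolP (y \in E)) => yE.
    by rewrite memNset ?subrr ?normr0// => /(_ (set_mem yE)).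
  by rewrite mem_set ?subr0 ?normr1//; move: yE; rewrite notin_setE.
- by apply: (key E) => // y /pl ->; rewrite sub0r normrN ger0_norm.
Qed.

Lemma L1dist_plateau z (r0 r : R) (ys : seq X) : 0 < r ->
  (forall y, ball z r0 y -> exists2 x, x \in ys & mdist x y < r / 2) ->
  (L1dist mu E (ball z r0) (plateau r) <=
   (theta^-1 * \sum_(x <- ys) mixed mu E x (2 * r))%:E)%E.
Proof.
move=> r_gt0 net.
apply: (@le_trans _ _ (\sum_(x <- ys) L1dist mu E (ball x (r / 2)) (plateau r))%E).
  apply: (@mint_cover _ _ mu X (fun x => ball x (r / 2)) (ball z r0)).
  - by move=> x; exact: ball_measurable.
  - exact: ball_measurable.
  - apply/measurable_EFinP; apply: measurableT_comp => //.
    by apply: measurable_funB; [exact: plateau_measurable|exact: chi_measurable].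
  - by move=> y; exact: abse_ge0.
  - by move=> y /net[x xys xy]; exists x => //; rewrite in_ball.
rewrite mulr_sumr -sumEFin; apply: lee_sum => x _; exact: L1dist_plateau_ball.
Qed.

End plateau.

(** * Smallness of mixed balls near points of uniform density *)

Section concentration.
Context {R : realType} {X : completeMetricType R}.
Context (mu : {outer_measure set X -> \bar R}).
Implicit Types (x y z : X) (r s : R) (A B D E : set X).

Local Notation T := (caratheodory_type mu).
Local Notation m := (mu : set T -> \bar R).

Context (mu_regular : borel_regular mu) (mu_doubling : doubling mu).
Context (E : set X) (mE : mu.-caratheodory E).
Context (CP lam : R) (CP0 : 0 < CP) (lam1 : 1 <= lam)
  (PI : poincare_with mu CP lam).
Context (v : nat -> X -> R) (g : nat -> X -> \bar R) (M : R)
  (vg : approximation mu E v g M).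

(** In [U], every finite family of [th]-mixed balls of radii at most [rho] whose
    [lam]-enlargements are disjoint and contained in [U] has a small sum of the
    ratios measure / radius. *)
Definition thin (th : R) (U : set X) (rho eps : R) : Prop :=
  forall (s : seq X) (rad : X -> R), uniq s ->
    (forall x, x \in s -> [/\ 0 < rad x, rad x <= rho,
      ball x (lam * rad x) `<=` U &
      th * vol mu (ball x (rad x)) <= mixed mu E x (rad x)]) ->
    trivIset [set` s] (fun x => ball x (lam * rad x)) ->
    \sum_(x <- s) vol mu (ball x (rad x)) / rad x <= eps.

Lemma le_mixed x y r s : ball x r `<=` ball y s ->
  mixed mu E x r <= mixed mu E y s.
Proof.
move=> xy; rewrite /mixed le_min !ge_min; apply/andP; split; apply/orP.
  by left; apply: (le_vol mu_doubling (x := y) (r := s)) => //; exact: setSI.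
by right; apply: (le_vol mu_doubling (x := y) (r := s)) => //; exact: setSI.
Qed.

Lemma finite_balls_bounded (s : seq X) (rad : X -> R) (x0 : X) :
  exists r0, forall x, x \in s -> ball x (rad x) `<=` ball x0 r0.
Proof.
elim: s => [|x s [r0 hr0]]; first by exists 0.
exists (Num.max (mdist x0 x + rad x) r0) => y; rewrite inE => /orP[/eqP->|/hr0 ys].
  by apply: sub_ball; rewrite le_max lexx.
by apply: (subset_trans ys); apply: sub_ball; rewrite mdistxx add0r le_max lexx orbT.
Qed.

Let M0 : 0 <= M.
Proof.
exact: le_trans (energy_ge0 vg 0 setT) (energy_leM mu_regular vg 0 measurableT).
Qed.

Let lam0 : 0 < lam. Proof. exact: lt_le_trans lam1. Qed.

(** The summed isoperimetric inequality for the balls of radius [2 r] centred at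
    the points of an [r / 2]-separated sequence, whose overlap is bounded. *)
Lemma net_sum (N : nat) :
  (forall y r (s : seq X), 0 < r -> separated r s ->
    (count (fun x => y \in (ball x (4 * lam * r) : set X)) s <= N)%N) ->
  forall r (xs : seq X) (G : set X) (delta : R), 0 < r -> separated (r / 2) xs ->
  (forall x, x \in xs -> L1cvg_on mu E v (ball x (2 * r))) ->
  (forall x, x \in xs -> ball x (lam * (2 * r)) `<=` G) ->
  measurable (G : set T) -> 0 < delta ->
  exists n0, forall i, (n0 <= i)%N ->
    \sum_(x <- xs) mixed mu E x (2 * r) <=
    2 * r * (delta + CP * (N%:R * energy mu g i G)).
Proof.
move=> hN r xs G delta r0 sxs cvgx xG mG delta0.
have r20 : 0 < 2 * r by rewrite mulr_gt0.
have [|n0 hn0] := @sum_isoperimetric _ _ mu mu_regular mu_doubling E mE CP lam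
    CP0 lam1 PI v g M vg xs (fun=> 2 * r) N G delta (fun _ _ => r20) cvgx xG mG _ delta0.
  move=> y; rewrite (_ : lam * (2 * r) = 4 * lam * (r / 2)); last by field.
  by apply: hN => //; rewrite divr_gt0.
exists n0 => i /hn0; rewrite -mulr_suml ler_pdivrMr//.
by move=> /le_trans; apply; rewrite mulrC.
Qed.

(** Let [D] be a set of points such that, in every ball of radius less than
    [kappa] around them, the smaller piece occupies at most the fraction [c], and
    such that the approximating sequence converges in L1 on their balls of radius
    [kappa].  Then mixed balls in small neighbourhoods of [D] have arbitrarily
    small sums.  The constant [c] does not depend on [D] or on [kappa]. *)
Lemma thin_near_uniform_density : exists2 c : R, 0 < c & forall (D : set X) (kappa : R),
  0 < kappa -> (forall x, D x -> L1cvg_on mu E v (ball x kappa)) ->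
  (forall x r, D x -> 0 < r -> r < kappa ->
    mixed mu E x r <= c * vol mu (ball x r)) ->
  forall th eps : R, 0 < th -> 0 < eps ->
  exists2 rho, 0 < rho & thin th (thickening D rho) rho eps.
Proof.
have [C4 C41 hC4] := doubling_compare mu_doubling 4.
have [C5 C51 hC5] := doubling_compare mu_doubling (4 * lam).
have [N hN] := overlap_bound mu_regular mu_doubling (4 * lam).
have C40 : 0 < C4 by exact: lt_le_trans C41.
have C50 : 0 < C5 by exact: lt_le_trans C51.
pose theta := (4 * C4)^-1.
have th0 : 0 < theta by rewrite invr_gt0 mulr_gt0.
have thi0 : 0 < theta^-1 by rewrite invr_gt0.
(* With this [c], a ball of radius [2 r] that is mixed with the fraction [theta]
   has its centre at distance at least [3 lam r] from [D] (see [avoid]). *)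
exists (theta / (2 * C5)); first by rewrite divr_gt0// mulr_gt0.
move=> D kappa kappa0 cvgD thinD th eps th_gt0 eps0.
have mD s : measurable (thickening D s : set T).
  by apply: (open_measurable mu_regular); exact: thickening_open.
have avoid x d r : 0 < r -> 5 * lam * r < kappa -> mixed_at mu E C4 r x ->
    D d -> mdist d x < 3 * lam * r -> False.
  move=> r0 rk xm Dd dx.
  have lr : r <= lam * r by rewrite ler_peMl// ltW.
  have xd : ball x (2 * r) `<=` ball d (5 * lam * r) by apply: sub_ball; lra.
  have dx' : ball d (5 * lam * r) `<=` ball x (4 * lam * (2 * r)).
    by apply: sub_ball; rewrite metric_sym; lra.
  have r20 : 0 < 2 * r by lra.
  have hx : theta * vol mu (ball x (2 * r)) <= mixed mu E x (2 * r) := xm.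
  have hd := thinD d (5 * lam * r) Dd (ltac:(lra)) rk.
  have h1 := le_mixed xd.
  have h2 := hC5 d x (2 * r) _ r20 dx'.
  have v0 := vol_ball_gt0 mu_doubling x r20.
  have h3 : theta / (2 * C5) * vol mu (ball d (5 * lam * r)) <=
      theta / 2 * vol mu (ball x (2 * r)).
    apply: (@le_trans _ _ (theta / (2 * C5) * (C5 * vol mu (ball x (2 * r))))).
      by rewrite ler_pM2l// divr_gt0// mulr_gt0.
    rewrite le_eqVlt; apply/orP; left; apply/eqP; field.
    by rewrite gt_eqF.
  have : 0 < theta * vol mu (ball x (2 * r)) by rewrite mulr_gt0.
  lra.
pose K := 1 + 4 * CP * theta^-1 * (1 + CP * N%:R).
have CPN0 : 0 <= CP * N%:R by rewrite mulr_ge0// ltW.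
have K0 : 0 < K.
  rewrite /K ltr_wpDr// mulr_ge0//; last by lra.
  by rewrite mulr_ge0 ?invr_ge0 ?(ltW th0)// mulr_ge0// ltW.
pose eta := th * eps / K.
have eta0 : 0 < eta by rewrite divr_gt0// mulr_gt0.
(* A scale [s0] such that for every smaller [r] the region between the [r]- and
   the [s0]-neighbourhood of [D] has energy at most [eta] infinitely often. *)
have [s0 [s00 s0k hs0]] := @pigeonhole_scale _ (fun i s => energy mu g i (thickening D s))
  M eta (kappa / 2) (fun i s => introT andP (conj (energy_ge0 vg i _)
    (energy_leM mu_regular vg i (mD s)))) eta0 (divr_gt0 kappa0 (ltr0Sn _ 1)).
exists (s0 / 2); first by rewrite divr_gt0.
move=> s rad us hs trs.
pose W : set X := \bigcup_(x in [set` s]) ball x (lam * rad x).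
have mW : measurable (W : set T).
  apply: (open_measurable mu_regular); apply: bigcup_open => x _; exact: open_ball.
have WD : W `<=` thickening D (s0 / 2).
  by move=> y [x xs xy]; have [_ _ xD _] := hs x xs; exact: xD.
have [r1 hr1] := finite_balls_bounded s (fun x => lam * rad x) point.
have Wr1 : W `<=` ball point r1 by move=> y [x xs]; exact: hr1.
pose C' := theta^-1 * (2 * (1 + CP * (N%:R * M))).
have C'0 : 0 <= C'.
  have : 0 <= CP * (N%:R * M) by rewrite mulr_ge0 ?(ltW CP0)// mulr_ge0.
  by move=> h; rewrite mulr_ge0 ?invr_ge0 ?(ltW th0)//; lra.
pose Q := \sum_(x <- s) (rad x)^-1.
have Q0 : 0 <= Q.
  rewrite /Q big_seq; apply: sumr_ge0 => x xs.
  by have [? _ _ _] := hs x xs; rewrite invr_ge0 ltW.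
(* The scale of the plateau: small with respect to [s0], and so small that the
   errors made by replacing the characteristic function by the plateau in the
   balls of the family, divided by the radii, have a sum of at most [eta]. *)
pose r := Num.min (s0 / (20 * lam)) (eta / (Q * C' + 1)).
have QC0 : 0 < Q * C' + 1 by rewrite ltr_wpDl// mulr_ge0.
have r0 : 0 < r by rewrite /r lt_min !divr_gt0// mulr_gt0.
have rs0 : 20 * lam * r <= s0.
  have : r <= s0 / (20 * lam) by rewrite /r ge_min lexx.
  by rewrite ler_pdivlMr 1?mulr_gt0// mulrC.
have reta : Q * (C' * r) <= eta.
  have : r <= eta / (Q * C' + 1) by rewrite /r ge_min lexx orbT.
  by rewrite ler_pdivlMr// mulrA mulrDr mulr1 [r * _]mulrC; lra.
have lr : r <= lam * r by rewrite ler_peMl// ltW.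
(* The transition set inside [W] is covered by balls of radius [2 r] centred at
   a net of [Z], whose enlargements lie in a region [G] of energy at most [eta]. *)
pose Z : set X := [set x | mixed_at mu E C4 r x /\ exists2 y, W y & mdist x y < r].
have r20 : 0 < r / 2 by rewrite divr_gt0.
have [|xs [sxs xsZ xsnet]] := @bounded_net _ _ mu mu_regular mu_doubling Z
    point (r1 + r) (r / 2) r20.
  move=> x [_ [y /Wr1]]; rewrite !in_ball => py xy.
  by have := metric_triangle point y x; rewrite (metric_sym y x); lra.
have cvg2 x : thickening D (s0 / 2 + r) x -> L1cvg_on mu E v (ball x (2 * r)).
  move=> [d Dd]; rewrite in_ball => dx.
  apply: (@L1cvg_onS _ _ mu mu_regular E mE v g M vg _ (ball d kappa)).
  - exact: ball_measurable.
  - exact: ball_measurable.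
  - by apply: sub_ball; lra.
  - exact: cvgD.
pose G := thickening D s0 `\` thickening D r.
have rlt : r < s0 by lra.
have ZD x : Z x -> thickening D (s0 / 2 + r) x.
  by move=> [_ [y /WD yD xy]]; apply: thickening_ball yD _; rewrite metric_sym.
have [||n0 hn0] := @net_sum N hN r xs G eta r0 sxs _ _ (measurableD (mD s0) (mD r)) eta0.
- by move=> x /xsZ/ZD; exact: cvg2.
- move=> x /xsZ Zx y; rewrite in_ball => xy; split.
    apply: (@thickeningS _ _ D (s0 / 2 + r + lam * (2 * r))); first by lra.
    by apply: thickening_ball xy; exact: ZD.
  move=> [d Dd]; rewrite in_ball => dy.
  apply: (@avoid x d r r0 _ Zx.1 Dd); first by lra.
  by have := metric_triangle d y x; rewrite (metric_sym y x); lra.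
have [i ni hi] := hs0 r r0 rlt n0.
have Gi : energy mu g i G <= eta.
  rewrite (energyD mu_regular vg)//; first by rewrite lerBlDl.
  by apply: thickeningS; exact: ltW.
have {hn0}sumZ : \sum_(x <- xs) mixed mu E x (2 * r) <=
    2 * r * (eta * (1 + CP * N%:R)).
  apply: (le_trans (hn0 i ni)); rewrite ler_pM2l ?mulr_gt0//.
  have := ler_wpM2l CPN0 Gi; lra.
have mtr := transition_measurable mu_regular E C4 r.
have WtrW A : A `<=` W -> A `&` transition mu E C4 r `<=` ball point r1.
  by move=> AW y [/AW/Wr1].
have volZ : vol mu (W `&` transition mu E C4 r) <=
    theta^-1 * (2 * r * (eta * (1 + CP * N%:R))).
  apply: (@le_trans _ _ (\sum_(x <- xs) vol mu (ball x (2 * r)))).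
    rewrite -lee_fin (volE mu_doubling (WtrW W (@subset_refl _ _))) -sumEFin.
    have mWtr : measurable (W `&` transition mu E C4 r : set T) by exact: measurableI.
    have := @mint_cover _ _ mu X (fun x => ball x (2 * r))
      (W `&` transition mu E C4 r) (cst 1%E) xs
      (fun x => ball_measurable mu_regular x _) mWtr (measurable_cst _) (fun=> lee01).
    rewrite mint_cst// mul1e => h.
    apply: (le_trans (h _)).
      move=> y [Wy [x xm xy]]; rewrite in_ball in xy.
      have [|x' x'xs x'x] := xsnet x; first by split => //; exists y.
      exists x' => //; rewrite in_ball.
      by have := metric_triangle x' x y; lra.
    apply: lee_sum => x _; rewrite mint_cst ?mul1e ?(vol_ballE mu_doubling)//.
    exact: ball_measurable.
  apply: (@le_trans _ _ (theta^-1 * \sum_(x <- xs) mixed mu E x (2 * r))); last first.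
    by apply: ler_wpM2l sumZ; rewrite invr_ge0 ltW.
  rewrite mulr_sumr big_seq [leRHS]big_seq; apply: ler_sum => x /xsZ[xm _].
  by rewrite ler_pdivlMl.
(* On each ball of the family the plateau is close to the characteristic
   function, the energy being only bounded by [M] there. *)
have distz z : z \in s -> (L1dist mu E (ball z (rad z)) (plateau mu E r) <= (C' * r)%:E)%E.
  move=> zs; have [radz _ zD _] := hs z zs.
  have zW : ball z (rad z) `<=` W.
    move=> y zy; exists z => //; apply: sub_ball zy.
    by rewrite mdistxx add0r ler_peMl// ltW.
  have [ys [sys ysB ysnet]] := @bounded_net _ _ mu mu_regular mu_doubling
    (ball z (rad z)) z (rad z) (r / 2) r20 (@subset_refl _ _).
  have [||n1 hn1] := @net_sum N hN r ys setT 1 r0 sys _ _ measurableT ltr01.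
  - move=> x /ysB/zW/WD xD; apply: cvg2.
    by apply: (@thickeningS _ _ D (s0 / 2)) xD; lra.
  - by [].
  apply: (le_trans (L1dist_plateau mu_regular mu_doubling mE C41 hC4 r0 ysnet)).
  rewrite lee_fin /C' -[leRHS]mulrA ler_pM2l//.
  apply: (le_trans (hn1 n1 (leqnn _))); rewrite mulrAC ler_pM2r// ler_pM2l//.
  by rewrite lerD2l ler_pM2l// ler_wpM2l// (energy_leM mu_regular vg).
(* The isoperimetric inequality for the plateau. *)
have mixz z : z \in s -> mixed mu E z (rad z) / rad z <= (rad z)^-1 * (C' * r) +
    CP * (2 / r) * vol mu (ball z (lam * rad z) `&` transition mu E C4 r).
  move=> zs; have [radz _ zD _] := hs z zs.
  have := isoperimetric mu_regular mu_doubling mE CP0 lam1 PI z radz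
    (locally_lipschitz_measurable mu_regular (plateau_locally_lipschitz mu E r0))
    (locally_lipschitz_L1_loc mu_regular mu_doubling (plateau_locally_lipschitz mu E r0))
    (plateau_upper_gradient mu_doubling mE C41 hC4 r0).
  rewrite mint_transition//; last exact: ball_measurable.
  rewrite -(volE mu_doubling (x := point) (r := r1)); last first.
    by apply: WtrW => y zy; exists z.
  rewrite -!EFinM => h.
  have {}h := le_trans h (leeD (distz z zs) (lexx _)).
  rewrite -EFinD lee_fin in h.
  rewrite ler_pdivrMr//; apply: (le_trans h); rewrite le_eqVlt; apply/orP; left.
  by apply/eqP; field; rewrite !gt_eqF.
have sumvol : \sum_(z <- s) vol mu (ball z (lam * rad z) `&` transition mu E C4 r) <=
    vol mu (W `&` transition mu E C4 r).
  rewrite -lee_fin (volE mu_doubling (WtrW W (@subset_refl _ _))) -sumEFin.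
  have -> : (\sum_(z <- s) (vol mu (ball z (lam * rad z) `&` transition mu E C4 r))%:E =
      \sum_(z <- s) mu (ball z (lam * rad z) `&` transition mu E C4 r))%E.
    apply: eq_big_seq => z zs; rewrite (volE mu_doubling (x := point) (r := r1))//.
    by apply: WtrW => y zy; exists z.
  apply: (@sum_mu_disjoint _ _ mu X
    (fun z => ball z (lam * rad z) `&` transition mu E C4 r)) => //.
  - by move=> z; apply: measurableI => //; exact: ball_measurable.
  - exact: measurableI.
  - by move=> z zs; apply: setSI => y zy; exists z.
  - move=> a b sa sb [y [[ya _] [yb _]]]; apply: trs => //.
    by exists y.
have final : \sum_(z <- s) mixed mu E z (rad z) / rad z <= eta * K.
  apply: (@le_trans _ _ (\sum_(z <- s) ((rad z)^-1 * (C' * r) +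
    CP * (2 / r) * vol mu (ball z (lam * rad z) `&` transition mu E C4 r)))).
    by rewrite big_seq [leRHS]big_seq; apply: ler_sum => z; exact: mixz.
  rewrite big_split/= -mulr_suml -mulr_sumr -/Q.
  have CPr : 0 <= CP * (2 / r) by rewrite mulr_ge0 ?divr_ge0// ltW.
  have h1 := ler_wpM2l CPr (le_trans sumvol volZ).
  apply: (le_trans (lerD reta h1)); rewrite le_eqVlt; apply/orP; left; apply/eqP.
  by rewrite /K; field; rewrite !gt_eqF.
have etaK : eta * K = th * eps by rewrite /eta divfK// gt_eqF.
rewrite -(ler_pM2l th_gt0) -etaK; apply: le_trans final.
rewrite mulr_sumr big_seq [leRHS]big_seq; apply: ler_sum => z zs.
have [radz _ _ hz] := hs z zs.
by rewrite mulrA ler_pM2r ?invr_gt0.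
Qed.

End concentration.

(** * Series of Borel weights *)

Section borel_series.
Context {R : realType} {X : completeMetricType R}.
Context (mu : {outer_measure set X -> \bar R}) (mu_regular : borel_regular mu).
Context (f : nat -> X -> \bar R) (bf : forall n, nonneg_borel_fun (f n)).
Local Open Scope ereal_scope.

(** The pointwise sum of a sequence of nonnegative Borel functions. *)
Definition borel_series (x : X) : \bar R := \sum_(n <oo) f n x.

Lemma le_borel_series n x : f n x <= borel_series x.
Proof.
have f0 k : 0 <= f k x by exact: (bf k).2.
apply: (@le_trans _ _ (\sum_(0 <= i < n.+1) f i x)).
  by rewrite big_nat_recr//= leeDr// sume_ge0.
exact: nneseries_lim_ge.
Qed.

Lemma borel_series_nonneg_borel : nonneg_borel_fun borel_series.
Proof.
split; last by move=> x; apply: nneseries_ge0 => n _ _; exact: (bf n).2.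
by apply: ge0_emeasurable_sum => n *; [exact: (bf n).2|exact: (bf n).1].
Qed.

Lemma mint_borel_series (B : \bar R) :
  (forall N, \sum_(0 <= n < N) mint mu setT (f n) <= B) ->
  mint mu setT borel_series <= B.
Proof.
move=> hB; rewrite /mint /borel_series integral_nneseries//.
- apply: lime_le.
    by apply: is_cvg_nneseries => n _ _; apply: mint_ge0 => y; exact: (bf n).2.
  by apply: nearW => N; exact: hB.
- by move=> n; exact: borel_fun_measurable.
- by move=> n x _; exact: (bf n).2.
Qed.

Lemma curve_integral_borel_series (gamma : curve X) n :
  curve_integral gamma (f n) <= curve_integral gamma borel_series.
Proof.
apply: ge0_le_integral => //.
- by move=> t _; exact: (bf n).2.
- exact: (curve_comp_measurable (bf n)).
- exact: (curve_comp_measurable borel_series_nonneg_borel).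
- by move=> t _; exact: le_borel_series.
Qed.

End borel_series.

(** Connectedness of an interval: two properties that cover it, and exclude one
    another locally, cannot hold one at each end point. *)
Lemma interval_not_separated {R : realType} (P Q : R -> Prop) (t0 t1 : R) :
  t0 <= t1 ->
  (forall t, t0 <= t <= t1 -> P t \/ Q t) ->
  (forall t, t0 <= t <= t1 -> exists2 delta, 0 < delta &
    forall t', t0 <= t' <= t1 -> `|t' - t| < delta ->
      (P t -> ~ Q t') /\ (Q t -> ~ P t')) ->
  P t0 -> Q t1 -> False.
Proof.
move=> t01 PQ loc Pt0 Qt1.
pose S := [set t | t0 <= t <= t1 /\ P t].
have St0 : S t0 by rewrite /S /= lexx t01.
have supS : has_sup S.
  by split; [exists t0|exists t1 => t [/andP[]]].
have tau0 : t0 <= sup S by apply: (ub_le_sup supS.2).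
have tau1 : sup S <= t1 by apply: ge_sup; [exists t0|move=> t [/andP[]]].
have taui : t0 <= sup S <= t1 by rewrite tau0.
have [delta delta0 hd] := loc _ taui.
have self : `|sup S - sup S| < delta by rewrite subrr normr0.
case: (PQ _ taui) => [Pt|Qt].
- have tlt : sup S < t1.
    rewrite lt_neqAle tau1 andbT; apply/eqP => te.
    by have [/(_ Pt) + _] := hd _ taui self; apply; rewrite te.
  pose t' := Num.min (sup S + delta / 2) t1.
  have t't : sup S < t' by rewrite /t' lt_min tlt andbT; lra.
  have t't1 : t' <= t1 by rewrite /t' ge_min lexx orbT.
  have t'd : t' <= sup S + delta / 2 by rewrite /t' ge_min lexx.
  have t'i : t0 <= t' <= t1 by apply/andP; split; lra.
  have [|/(_ Pt) nQ _] := hd t' t'i; first by rewrite ger0_norm; lra.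
  have Pt' : P t' by case: (PQ _ t'i).
  have : t' <= sup S by apply: (ub_le_sup supS.2).
  lra.
- have [t' [t'i Pt'] tt'] := sup_adherent delta0 supS.
  have t't : t' <= sup S by apply: (ub_le_sup supS.2).
  have [|_ /(_ Qt)] := hd t' t'i; last exact.
  by rewrite distrC ger0_norm; lra.
Qed.

(** * Points of vanishing density *)

Section density.
Context {R : realType} {X : completeMetricType R}.
Context (mu : {outer_measure set X -> \bar R}).
Implicit Types (x y z : X) (r s : R) (A E : set X).

(** The density of [A] at [x] is 0. *)
Definition vanishing A x : Prop := forall c : R, 0 < c ->
  exists2 r0 : R, 0 < r0 & forall r, 0 < r -> r < r0 ->
    vol mu (ball x r `&` A) <= c * vol mu (ball x r).

Context (mu_regular : borel_regular mu) (mu_doubling : doubling mu).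

Lemma density_ratioE A x r : 0 < r ->
  density_ratio mu A x r = (vol mu (ball x r `&` A) / vol mu (ball x r))%:E.
Proof.
move=> r0; have v0 := vol_ball_gt0 mu_doubling x r0.
rewrite /density_ratio -(@volE _ _ mu mu_doubling _ x r)// -vol_ballE//.
by rewrite inver gt_eqF// -EFinM.
Qed.

Lemma upper_density_vanishing A x : (upper_density mu A x <= 0)%E -> vanishing A x.
Proof.
move=> ud c c0.
have /ereal_inf_lt[_ [V V0 <-] Vc] : (upper_density mu A x < c%:E)%E.
  by apply: le_lt_trans ud _; rewrite lte_fin.
have [r0 r00 hr0] := V0; exists r0 => // r rgt rlt.
have Vr : V r.
  by apply: hr0 => //=; rewrite sub0r normrN gtr0_norm.
have : (density_ratio mu A x r < c%:E)%E.
  by apply: le_lt_trans Vc; apply: ereal_sup_ubound; exists r.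
rewrite density_ratioE// lte_fin ltr_pdivrMr; last exact: vol_ball_gt0.
exact: ltW.
Qed.

Lemma exterior_vanishing E x : measure_exterior mu E x -> vanishing E x.
Proof.
move=> ext c c0.
have /fine_cvgP[[r1 r10 fin] /cvgrPdist_lt/(_ _ c0)[r2 r20 hr]] := ext.
exists r2 => // r rgt rlt.
have := hr r _ rgt; rewrite /= !sub0r !normrN gtr0_norm// => /(_ rlt).
rewrite density_ratioE//= => h.
have {}h := le_lt_trans (ler_norm _) h.
rewrite ltr_pdivrMr in h; last exact: vol_ball_gt0.
exact: ltW.
Qed.

Lemma interior_vanishing E x : mu.-caratheodory E ->
  measure_interior mu E x -> vanishing (~` E) x.
Proof.
move=> mE int c c0.
have /fine_cvgP[[r1 r10 fin] /cvgrPdist_lt/(_ _ c0)[r2 r20 hr]] := int.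
exists r2 => // r rgt rlt.
have := hr r _ rgt; rewrite /= sub0r !normrN gtr0_norm// => /(_ rlt).
rewrite density_ratioE//= => h.
have {}h := le_lt_trans (ler_norm _) h.
have v0 := vol_ball_gt0 mu_doubling x rgt.
rewrite ltrBlDr -ltrBlDl ltr_pdivlMr// in h.
by have := vol_split mu_doubling x r mE; lra.
Qed.

Lemma mixedC E x r : mixed mu (~` E) x r = mixed mu E x r.
Proof.
by rewrite /mixed setCK minC.
Qed.

Context (C4 : R) (C41 : 1 <= C4)
  (hC4 : forall x y r s, 0 < r -> ball x s `<=` ball y (4 * r) ->
    vol mu (ball x s) <= C4 * vol mu (ball y r)).

Let theta := (1 + C4)^-1.

Let theta_gt0 : 0 < theta.
Proof.
by rewrite invr_gt0; move: C41; lra.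
Qed.

Let thetaC4 : theta + theta * C4 = 1.
Proof.
by rewrite /theta -{1}[_^-1]mulr1 -mulrDr mulVf// gt_eqF//; move: C41; lra.
Qed.

(** In comparable balls, [E] cannot occupy a small fraction of one and its
    complement a small fraction of the other. *)
Lemma not_both_small E x y r s : mu.-caratheodory E -> 0 < r ->
  ball y r `<=` ball x s -> ball x s `<=` ball y (4 * r) ->
  vol mu (ball x s `&` E) < theta * vol mu (ball x s) ->
  vol mu (ball y r `&` ~` E) < theta * vol mu (ball y r) -> False.
Proof.
move=> mE r0 yx xy inx outy.
have := vol_split mu_doubling y r mE.
have v0 := vol_ball_gt0 mu_doubling y r0.
have : vol mu (ball y r `&` E) <= vol mu (ball x s `&` E).
  by apply: (le_vol mu_doubling (x := x) (r := s)) => //; exact: setSI.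
have := hC4 r0 xy; rewrite -(ler_pM2l theta_gt0) mulrA => h.
have : (theta + theta * C4) * vol mu (ball y r) = vol mu (ball y r) by rewrite thetaC4 mul1r.
rewrite mulrDl; lra.
Qed.

(** If no ball of radius at most [sigma] around [x] is mixed, then vanishing
    density propagates from the infinitesimal scales up to the scale [sigma]:
    when the radius doubles, the smaller piece cannot change sides. *)
Lemma vanishing_small E x (sigma : R) : mu.-caratheodory E -> 0 < sigma ->
  (forall r, 0 < r -> r <= sigma ->
    mixed mu E x r < theta * vol mu (ball x r)) ->
  vanishing E x ->
  vol mu (ball x sigma `&` E) < theta * vol mu (ball x sigma).
Proof.
move=> mE s0 hmix /(_ (theta / 2) (divr_gt0 theta_gt0 (ltr0Sn _ 1)))[r0 r00 hr0].
have [n hn] : exists n, sigma / 2 ^+ n < r0.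
  exists (Num.truncn (sigma / r0)).+1; rewrite ltr_pdivrMr ?exprn_gt0//.
  rewrite mulrC -ltr_pdivrMr//; apply: (lt_trans (truncnS_gt _)).
  by rewrite -natrX ltr_nat ltn_expl.
suff main k : (k <= n)%N -> vol mu (ball x (sigma / 2 ^+ (n - k)) `&` E) <
    theta * vol mu (ball x (sigma / 2 ^+ (n - k))).
  by have := main n (leqnn n); rewrite subnn expr0 divr1.
elim: k => [_|k IH kn].
  rewrite subn0; have sn0 : 0 < sigma / 2 ^+ n by rewrite divr_gt0// exprn_gt0.
  apply: (le_lt_trans (hr0 _ sn0 hn)); rewrite ltr_pM2r ?vol_ball_gt0//.
  by move: theta_gt0; lra.
have {IH} := IH (ltnW kn); rewrite -(subnSK kn) exprS invfM mulrCA mulrC.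
set r := sigma / _ => hr.
have rgt : 0 < r by rewrite divr_gt0// exprn_gt0.
have rs : r <= sigma.
  by rewrite ler_pdivrMr ?exprn_gt0// ler_peMr ?(ltW s0)// exprn_ege1// ler1n.
have := hmix r rgt rs; rewrite /mixed gt_min => /orP[//|out].
exfalso; have r20 : 0 < r / 2 by rewrite divr_gt0.
have mEC : mu.-caratheodory (~` E) by exact: caratheodory_measurable_setC.
apply: (@not_both_small (~` E) x x (r / 2) r mEC r20 _ _ out); last by rewrite setCK.
- by apply: sub_ball; rewrite mdistxx; lra.
- by apply: sub_ball; rewrite mdistxx; lra.
Qed.

Lemma vanishing_locally_constant E x y (sigma : R) : mu.-caratheodory E ->
  0 < sigma -> mdist x y < sigma ->
  (forall r, 0 < r -> r <= 2 * sigma ->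
    mixed mu E x r < theta * vol mu (ball x r)) ->
  (forall r, 0 < r -> r <= 2 * sigma ->
    mixed mu E y r < theta * vol mu (ball y r)) ->
  vanishing E x -> vanishing (~` E) y -> False.
Proof.
move=> mE s0 xy hx hy vx vy.
have mEC : mu.-caratheodory (~` E) by exact: caratheodory_measurable_setC.
have s20 : 0 < 2 * sigma by rewrite mulr_gt0.
apply: (@not_both_small E x y sigma (2 * sigma) mE s0 _ _ (vanishing_small mE s20 hx vx)).
- by apply: sub_ball; lra.
- by apply: sub_ball; rewrite metric_sym; lra.
- apply: (vanishing_small mEC s0) vy => r r0 rs; rewrite mixedC; apply: hy => //; lra.
Qed.

End density.

(** * Countable families with bounded finite sums *)

Section countable_families.
Context {R : realType} (T : choiceType).

Lemma countable_bounded_sums (V : set T) (w : T -> R) (B : R) :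
  (forall x, V x -> 0 < w x) ->
  (forall s : seq T, uniq s -> [set` s] `<=` V -> \sum_(x <- s) w x <= B) ->
  countable V.
Proof.
move=> w0 hB.
have -> : V = \bigcup_n (V `&` [set x | n.+1%:R^-1 < w x]).
  apply/seteqP; split => [x Vx|x [n _ []]//].
  have wx := w0 x Vx; exists (Num.truncn (w x)^-1) => //; split => //=.
  by rewrite invf_plt ?posrE// truncnS_gt.
apply: bigcup_countable => // n _; apply: finite_set_countable.
apply: contrapT => /(@infinite_set_fset _ _ (Num.truncn (B * n.+1%:R)).+1)[A AV hA].
pose s : seq T := finmap.enum_fset A.
have sV x : x \in s -> V x /\ n.+1%:R^-1 < w x by exact: AV.
have := hB s (finmap.fset_uniq A) (fun x xs => (sV x xs).1).
apply/negP; rewrite -ltNge.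
apply: (@lt_le_trans _ _ (\sum_(x <- s) n.+1%:R^-1)); last first.
  by rewrite big_seq [leRHS]big_seq; apply: ler_sum => x /sV[_ /ltW].
rewrite big_const_seq count_predT iter_addr_0 -[_ *+ size s]mulr_natl ltr_pdivlMr//.
by apply: (lt_le_trans (truncnS_gt _)); rewrite ler_nat.
Qed.

(** An injective enumeration of a countable set, with gaps. *)
Lemma countable_enumeration (V : set T) : countable V ->
  exists e : nat -> option T, [/\ forall n x, e n = Some x -> V x,
    forall n k x, e n = Some x -> e k = Some x -> n = k &
    forall x, V x -> exists n, e n = Some x].
Proof.
move=> /countable_injP[h hinj].
pose e n := match pselect (exists x, V x /\ h x = n) with
  | left p => Some (projT1 (cid p)) | right _ => None end.
have eE n x : e n = Some x -> V x /\ h x = n.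
  by rewrite /e; case: pselect => // p [<-]; exact: (projT2 (cid p)).
exists e; split.
- by move=> n x /eE[].
- by move=> n k x /eE[_ <-] /eE[_ <-].
- move=> x Vx; exists (h x); rewrite /e; case: pselect => [p|]; last first.
    by move=> np; exfalso; apply: np; exists x.
  congr Some; have [Vy hy] := projT2 (cid p).
  by apply: hinj; rewrite ?inE.
Qed.

(** A sum split into classes [kk x = k], the [k]-th being at most
    [eps / 2 ^ k.+1]. *)
Lemma sum_geometric_classes (s : seq T) (w : T -> R) (kk : T -> nat) (eps : R) :
  0 <= eps ->
  (forall k, \sum_(x <- s | kk x == k) w x <= eps / 2 ^+ k.+1) ->
  \sum_(x <- s) w x <= eps.
Proof.
move=> eps0 hk.
have main K : \sum_(x <- s | (kk x < K)%N) w x <= eps * (1 - (2 ^+ K)^-1).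
  elim: K => [|K IH]; first by rewrite big_pred0// expr0 invr1 subrr mulr0.
  rewrite (bigID (fun x => (kk x < K)%N))/=.
  have -> : \sum_(x <- s | (kk x < K.+1)%N && (kk x < K)%N) w x =
      \sum_(x <- s | (kk x < K)%N) w x.
    by apply: eq_bigl => x; apply: andb_idl => /ltnW.
  have -> : \sum_(x <- s | (kk x < K.+1)%N && ~~ (kk x < K)%N) w x =
      \sum_(x <- s | kk x == K) w x.
    by apply: eq_bigl => x; rewrite ltnS -leqNgt -eqn_leq.
  apply: (le_trans (lerD IH (hk K))); rewrite -mulrDr ler_wpM2l//.
  by rewrite exprS invfM; lra.
have -> : \sum_(x <- s) w x =
    \sum_(x <- s | (kk x < (\max_(x <- s) kk x).+1)%N) w x.
  rewrite big_seq [RHS]big_seq_cond; apply: eq_bigl => x.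
  by rewrite andb_idr// => xs; rewrite ltnS leq_bigmax_seq.
by apply: (le_trans (main _)); apply: ler_piMr => //; rewrite gerBl invr_ge0 exprn_ge0.
Qed.

End countable_families.

(** * Admissible weights for crossing curves *)

Section crossing_curves.
Context {R : realType} {X : completeMetricType R}.
Context (mu : {outer_measure set X -> \bar R}).
Implicit Types (x y z : X) (r s : R) (A D E : set X).

Local Notation T := (caratheodory_type mu).

Context (mu_regular : borel_regular mu) (mu_doubling : doubling mu).
Context (E : set X) (mE : mu.-caratheodory E).
Context (CP lam : R) (CP0 : 0 < CP) (lam1 : 1 <= lam)
  (PI : poincare_with mu CP lam).
Context (v : nat -> X -> R) (g : nat -> X -> \bar R) (M : R)
  (vg : approximation mu E v g M).

(** Between the times [t0] and [t1] the curve only visits points at which [E] or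
    its complement has density 0, and it changes from one sort to the other. *)
Definition crosses (gamma : curve X) (t0 t1 : R) : Prop :=
  [/\ 0 <= t0, t0 < t1, t1 <= len gamma,
    forall t, t0 <= t <= t1 -> vanishing mu E (gamma t) \/ vanishing mu (~` E) (gamma t) &
    (vanishing mu E (gamma t0) /\ vanishing mu (~` E) (gamma t1)) \/
    (vanishing mu (~` E) (gamma t0) /\ vanishing mu E (gamma t1))].

(** [E] and its complement cannot both have density 0 at a point. *)
Lemma vanishing_excl x : vanishing mu E x -> vanishing mu (~` E) x -> False.
Proof.
have c0 : 0 < 3^-1 :> R by [].
move=> /(_ _ c0)[r1 r10 h1] /(_ _ c0)[r2 r20 h2].
pose r := Num.min r1 r2 / 2.
have m0 : 0 < Num.min r1 r2 by rewrite lt_min r10.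
have r0 : 0 < r by rewrite divr_gt0.
have rm : r < Num.min r1 r2 by rewrite /r; lra.
have := h1 r r0; have := h2 r r0.
move: rm; rewrite lt_min => /andP[-> ->] /(_ isT) ? /(_ isT) ?.
have := vol_split mu_doubling x r mE.
have := vol_ball_gt0 mu_doubling x r0; lra.
Qed.

Lemma not_boundary_vanishing x : ~ measure_boundary mu E x ->
  vanishing mu E x \/ vanishing mu (~` E) x.
Proof.
move=> /not_andP[] /negP; rewrite -leNgt => /(upper_density_vanishing mu_doubling).
  by left.
by right.
Qed.

(** Weights of arbitrarily small integral that are admissible for the curves
    with a crossing whose end points are at distance at least [8 lam R0]. *)
Lemma exists_weight (eps R0 : R) : 0 < eps -> 0 < R0 ->
  exists rho : X -> \bar R, [/\ nonneg_borel_fun rho,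
    (mint mu setT rho <= eps%:E)%E &
    forall (gamma : curve X) (t0 t1 : R), crosses gamma t0 t1 ->
      8 * lam * R0 <= mdist (gamma t0) (gamma t1) ->
      (1 <= curve_integral gamma rho)%E].
Proof.
move=> eps0 R00.
have lam0 : 0 < lam by exact: lt_le_trans lam1.
have [C4 C41 hC4] := doubling_compare mu_doubling 4.
have [C6 C61 hC6] := doubling_compare mu_doubling (4 * lam).
have C60 : 0 < C6 by exact: lt_le_trans C61.
pose theta := (1 + C4)^-1.
have th0 : 0 < theta by rewrite invr_gt0; lra.
have [c c0 hthin] := thin_near_uniform_density mu_regular mu_doubling mE CP0 lam1 PI vg.
pose kap (k : nat) : R := k.+1%:R^-1.
have kap0 k : 0 < kap k by rewrite invr_gt0.
pose D (k : nat) : set X := [set x | L1cvg_on mu E v (ball x (kap k)) /\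
  forall r, 0 < r -> r < kap k -> mixed mu E x r <= c * vol mu (ball x r)].
have coverD x : vanishing mu E x \/ vanishing mu (~` E) x -> exists k, D k x.
  move=> vx.
  have [r1 r10 h1] : exists2 r1, 0 < r1 & forall r, 0 < r -> r < r1 ->
      mixed mu E x r <= c * vol mu (ball x r).
    case: vx => /(_ c c0)[r1 r10 h1]; exists r1 => // r r0 rr1;
      by rewrite /mixed ge_min h1// orbT.
  have [r2 r20 h2] := L1cvg_loc vg x.
  have m0 : 0 < Num.min r1 r2 by rewrite lt_min r10.
  exists (Num.truncn (Num.min r1 r2)^-1).
  have : kap (Num.truncn (Num.min r1 r2)^-1) < Num.min r1 r2.
    by rewrite /kap invf_plt ?posrE// truncnS_gt.
  rewrite lt_min => /andP[k1 k2]; split.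
    apply: (L1cvg_onS mu_regular mE vg _ _ _ h2); try exact: ball_measurable.
    by apply: sub_ball; rewrite mdistxx add0r ltW.
  by move=> r r0 rk; apply: h1 => //; exact: lt_trans k1.
pose eps' := eps / C6.
have eps'0 : 0 < eps' by rewrite divr_gt0.
have /choice[rho hrho] : forall k, exists rho, 0 < rho /\
    thin mu E lam theta (thickening (D k) rho) rho (eps' / 2 ^+ k.+1).
  move=> k; have [||||rho rho0 hrho] := hthin (D k) (kap k) (kap0 k) _ _ theta (eps' / 2 ^+ k.+1).
  - by move=> x [].
  - by move=> x r [_]; exact.
  - by [].
  - by rewrite divr_gt0// exprn_gt0.
  - by exists rho.
pose bad k z r := [/\ 0 < r, r <= R0, r <= rho k,
  ball z (lam * r) `<=` thickening (D k) (rho k) &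
  theta * vol mu (ball z r) <= mixed mu E z r].
(* The centres of small mixed balls; [kr] chooses an index and a radius. *)
pose A : set X := [set z | exists kr : nat * R, bad kr.1 z kr.2].
have /choice[kr hkr] : forall z, exists kr : nat * R, A z -> bad kr.1 z kr.2.
  move=> z; have [[kr hkr]|nA] := pselect (A z); first by exists kr.
  by exists (0%N, 0) => /nA.
pose rad z := (kr z).2; pose kk z := (kr z).1.
have hbad z : A z -> bad (kk z) z (rad z) := hkr z.
have [V [VA tV hV]] := @vitali_covering _ X A (fun z => lam * rad z) (lam * R0)
  (fun z Az => let: And5 r0 rR0 _ _ _ := hbad z Az in
     introT andP (conj (mulr_gt0 lam0 r0) (ler_wpM2l (ltW lam0) rR0))).
pose w z := vol mu (ball z (rad z)) / rad z.
have rad0 z : V z -> 0 < rad z by move=> /VA/hbad[].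
have w0 z : V z -> 0 < w z.
  by move=> /rad0 r0; rewrite /w divr_gt0// (vol_ball_gt0 mu_doubling).
have sumw (s : seq X) : uniq s -> [set` s] `<=` V -> \sum_(z <- s) w z <= eps'.
  move=> us sV; apply: (@sum_geometric_classes _ _ s w kk); first exact: ltW.
  move=> k; rewrite -big_filter; apply: (hrho k).2.
  - exact: filter_uniq.
  - move=> z; rewrite mem_filter => /andP[/eqP <- /sV/VA/hbad[? ? ? ? ?]].
    by split.
  - move=> a b; rewrite /= !mem_filter => /andP[_ /sV Va] /andP[_ /sV Vb].
    exact: tV.
have [e [eV einj eS]] := countable_enumeration (countable_bounded_sums w0 sumw).
pose f n (y : X) : \bar R := if e n is Some z then
  ((lam * rad z)^-1 * \1_(ball z (4 * lam * rad z)) y)%:E else 0%E.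
have bf n : nonneg_borel_fun (f n).
  rewrite /f; case en : (e n) => [z|]; last by split => // ; exact: measurable_cst.
  have r0 := rad0 z (eV _ _ en).
  split; last by move=> y; rewrite lee_fin mulr_ge0// invr_ge0 mulr_ge0// ltW.
  apply/measurable_EFinP; apply: measurable_funM => //.
  apply: (@measurable_indic _ (g_sigma_algebraType (@open X))).
  by apply: sub_sigma_algebra; exact: open_ball.
have mintf n : mint mu setT (f n) =
    (if e n is Some z then ((lam * rad z)^-1 * vol mu (ball z (4 * lam * rad z)))%:E
     else 0)%E.
  rewrite /mint /f; case en : (e n) => [z|]; last by rewrite integral0.
  have r0 := rad0 z (eV _ _ en).
  under eq_integral do rewrite EFinM.
  rewrite ge0_integralZl//.
  - rewrite integral_indic//; last exact: (ball_measurable mu_regular).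
    by rewrite setIT EFinM vol_ballE.
  - apply/measurable_EFinP; apply: measurable_indic.
    exact: (ball_measurable mu_regular).
  - by rewrite lee_fin invr_ge0 mulr_ge0// ltW.
exists (borel_series f); split; first exact: borel_series_nonneg_borel.
- apply: mint_borel_series => // N.
  pose s := pmap e (iota 0 N).
  have us : uniq s.
    rewrite /s; elim: (iota 0 N) (iota_uniq 0 N) => [//|n t IH] /= /andP[nt ut].
    case en : (e n) => [z|] /=; last exact: IH.
    rewrite IH// andbT mem_pmap; apply/mapP => -[k kt /esym ek].
    by move: nt; rewrite (einj n k z en ek) kt.
  have sV : [set` s] `<=` V.
    by move=> z /=; rewrite mem_pmap => /mapP[n _ /esym/eV].
  have -> : (\sum_(0 <= n < N) mint mu setT (f n) =
      \sum_(z <- s) ((lam * rad z)^-1 * vol mu (ball z (4 * lam * rad z)))%:E)%E.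
    rewrite /s /index_iota subn0; elim: (iota 0 N) => [|n t IH] /=.
      by rewrite !big_nil.
    rewrite big_cons IH mintf; case: (e n) => [z|] /=; last by rewrite add0e.
    by rewrite big_cons.
  rewrite sumEFin lee_fin.
  have -> : eps = C6 * eps' by rewrite /eps' mulrC divfK// gt_eqF.
  apply: (@le_trans _ _ (C6 * \sum_(z <- s) w z)); last first.
    by rewrite ler_pM2l//; exact: sumw.
  rewrite mulr_sumr big_seq [leRHS]big_seq; apply: ler_sum => z /sV/rad0 r0.
  have hv := hC6 z z (rad z) (4 * lam * rad z) r0 (@subset_refl _ _).
  rewrite ler_pdivrMl ?mulr_gt0// (le_trans hv)//.
  rewrite /w (_ : lam * rad z * (C6 * (vol mu (ball z (rad z)) / rad z)) =
    lam * (C6 * vol mu (ball z (rad z)))); last by field; rewrite gt_eqF.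
  by rewrite ler_peMl// mulr_ge0 ?vol_ge0// ltW.
move=> gamma t0 t1 [t00 t01 t1l vtt ends] far.
(* Off [A], the choice between [E] and its complement as the set of vanishing
   density would be locally constant along the crossing. *)
have [t ti At] : exists2 t, t0 <= t <= t1 & A (gamma t).
  apply: contrapT => noA.
  have loc t : t0 <= t <= t1 -> exists2 delta, 0 < delta &
      forall t', t0 <= t' <= t1 -> `|t' - t| < delta ->
      (vanishing mu E (gamma t) -> ~ vanishing mu (~` E) (gamma t')) /\
      (vanishing mu (~` E) (gamma t) -> ~ vanishing mu E (gamma t')).
    move=> ti; have [k Dk] := coverD _ (vtt t ti).
    have rho0 := (hrho k).1.
    pose delta := Num.min (rho k / (4 * lam)) (R0 / 2).
    have d0 : 0 < delta by rewrite /delta lt_min !divr_gt0// mulr_gt0.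
    have dR : 2 * delta <= R0.
      have : delta <= R0 / 2 by rewrite /delta ge_min lexx orbT.
      lra.
    have drho : 4 * lam * delta <= rho k.
      have : delta <= rho k / (4 * lam) by rewrite /delta ge_min lexx.
      by rewrite ler_pdivlMr 1?mulr_gt0// mulrC.
    have dl : delta <= lam * delta by rewrite ler_peMl// ltW.
    have close t' : t0 <= t' <= t1 -> `|t' - t| < delta ->
        mdist (gamma t) (gamma t') < delta.
      move=> /andP[? ?] tt'; move: ti => /andP[? ?].
      have [tt|tt] := leP t t'.
        apply: le_lt_trans tt'; rewrite ger0_norm ?subr_ge0//.
        by apply: curve_lip => //; lra.
      rewrite metric_sym; apply: le_lt_trans tt'; rewrite distrC gtr0_norm ?subr_gt0//.
      by apply: curve_lip => //; lra.
    have hmix t' : t0 <= t' <= t1 -> mdist (gamma t) (gamma t') < delta ->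
        forall r, 0 < r -> r <= 2 * delta ->
        mixed mu E (gamma t') r < theta * vol mu (ball (gamma t') r).
      move=> t'i tt' r r0 rd; rewrite ltNge; apply/negP => mr; apply: noA.
      exists t' => //; exists (k, r); split => //=; [lra|lra|].
      move=> y; rewrite in_ball => yr; exists (gamma t) => //; rewrite in_ball.
      have := metric_triangle (gamma t) (gamma t') y.
      have : lam * r <= lam * (2 * delta) by rewrite ler_pM2l.
      by have := mulr_gt0 lam0 d0; lra.
    exists delta => // t' t'i tt'.
    have ct := close t' t'i tt'.
    have ctt : mdist (gamma t) (gamma t) < delta by rewrite mdistxx.
    have mEC : mu.-caratheodory (~` E) by exact: caratheodory_measurable_setC.
    split.
      move=> a b; apply: (@vanishing_locally_constant _ _ mu mu_doubling C4 C41 hC4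
        E _ _ delta mE d0 ct (hmix t ti ctt) (hmix t' t'i ct) a b).
    move=> a b; apply: (@vanishing_locally_constant _ _ mu mu_doubling C4 C41 hC4
        (~` E) _ _ delta mEC d0 ct) a _; last by rewrite setCK.
    - by move=> r r0 rd; rewrite mixedC; exact: (hmix t ti ctt).
    - by move=> r r0 rd; rewrite mixedC; exact: (hmix t' t'i ct).
  case: ends => -[v0 v1].
  - exact: (interval_not_separated (ltW t01) vtt loc v0 v1).
  - apply: (@interval_not_separated _ (fun u => vanishing mu (~` E) (gamma u))
      (fun u => vanishing mu E (gamma u)) _ _ (ltW t01) _ _ v0 v1).
    + by move=> u /vtt[]; [right|left].
    + move=> u ui; have [d d0 hd] := loc u ui; exists d => // u' u'i uu'.
      by have [h1 h2] := hd u' u'i uu'; split.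
have [z Vz zt] := hV _ At.
have [n en] := eS z Vz.
have [rz0 rzR _ _ _] := hbad z (VA z Vz).
pose L := lam * rad z.
rewrite -/L in zt.
have L0 : 0 < L by rewrite mulr_gt0.
have LR : L <= lam * R0 by rewrite ler_pM2l.
(* The curve comes within [3 L] of [z], and one of the end points of the crossing
   is at distance at least [4 L]: a piece of length [L] lies in the ball. *)
have [te tei zte] : exists2 te, t0 <= te <= t1 & 4 * L <= mdist z (gamma te).
  have [h|h] := leP (4 * L) (mdist z (gamma t0)).
    by exists t0 => //; rewrite lexx ltW.
  exists t1; first by rewrite lexx ltW.
  have := metric_triangle (gamma t0) z (gamma t1); rewrite (metric_sym _ z).
  move: far; lra.
move: ti tei => /andP[tt0 tt1] /andP[te0 te1].
have lip a b : t0 <= a -> a <= b -> b <= t1 -> mdist (gamma a) (gamma b) <= b - a.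
  by move=> ? ? ?; apply: curve_lip => //; lra.
apply: le_trans (curve_integral_borel_series bf gamma n).
have finE y : f n y = ((lam * rad z)^-1 * \1_(ball z (4 * lam * rad z)) y)%:E.
  by rewrite /f en.
have inside u : mdist z (gamma u) < 4 * L -> ((L^-1)%:E <= f n (gamma u))%E.
  move=> zu; rewrite finE indicE mem_set ?mulr1//.
  by rewrite in_ball -mulrA.
have Li0 : 0 <= L^-1 by rewrite invr_ge0 ltW.
have tri := metric_triangle z (gamma t) (gamma te).
have [tte|tte] := leP t te.
- have far' := lip t te tt0 tte te1.
  have := @curve_integral_ge _ _ gamma (f n) t (t + L) L^-1 (bf n) Li0.
  rewrite addrAC subrr add0r mulVf ?gt_eqF//; apply; [lra|lra|lra|].
  move=> u /andP[tu utL]; apply: inside.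
  have := lip t u tt0 (ltW tu) (ltac:(lra)).
  have := metric_triangle z (gamma t) (gamma u); lra.
- have far' := lip te t te0 (ltW tte) tt1; rewrite metric_sym in far'.
  have := @curve_integral_ge _ _ gamma (f n) (t - L) t L^-1 (bf n) Li0.
  rewrite subKr mulVf ?gt_eqF//; apply; [lra|lra|lra|].
  move=> u /andP[tu utL]; apply: inside.
  have := lip u t (ltac:(lra)) (ltW utL) tt1; rewrite metric_sym.
  have := metric_triangle z (gamma t) (gamma u); lra.
Qed.

End crossing_curves.

Theorem corollary6p4 (R : realType) (X : completeMetricType R)
  (mu : {outer_measure set X -> \bar R})
  (mu_regular : borel_regular mu) (mu_doubling : doubling mu)
  (mu_poincare : poincare_1_1 mu)
  (E : set X) (E_fin_per : finite_perimeter mu E) :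
  modulus1 mu
    [set gamma : curve X | exists t0 t1 : R,
      [/\ t0 \in `[0, len gamma], t1 \in `[0, len gamma], t0 < t1 &
        [/\ measure_interior mu E (gamma t0),
            measure_exterior mu E (gamma t1) &
            (gamma @` `[t0, t1]) `&` measure_boundary mu E = set0]
        \/
        [/\ measure_exterior mu E (gamma t0),
            measure_interior mu E (gamma t1) &
            (gamma @` `[t0, t1]) `&` measure_boundary mu E = set0]]]
  = 0%E.
Proof.
have mE := E_fin_per.1.
have [CP [lam [CP0 lam1 PI]]] := mu_poincare.
have [v [g [M vg]]] := finite_perimeter_approximation E_fin_per.
set Gamma := [set gamma : curve X | _].
have crossG (gamma : curve X) : Gamma gamma -> exists t0 t1, crosses mu E gamma t0 t1.
  move=> [t0 [t1 []]]; rewrite !in_itv/= => /andP[t00 _] /andP[_ t1l] t01 h.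
  exists t0, t1.
  have vtt : (gamma @` `[t0, t1]) `&` measure_boundary mu E = set0 ->
      forall t, t0 <= t <= t1 -> vanishing mu E (gamma t) \/ vanishing mu (~` E) (gamma t).
    move=> h0 t ti; apply: (not_boundary_vanishing mu_doubling) => bt.
    have : ((gamma @` `[t0, t1]) `&` measure_boundary mu E) (gamma t).
      by split => //; exists t => //=; rewrite in_itv.
    by rewrite h0.
  case: h => -[h0 h1 hb]; split => //; try exact: vtt.
  - right; split; first exact: (interior_vanishing mu_doubling mE).
    exact: (exterior_vanishing mu_doubling).
  - left; split; first exact: (exterior_vanishing mu_doubling).
    exact: (interior_vanishing mu_doubling mE).
apply/eqP; rewrite eq_le; apply/andP; split; last first.
  by apply: le_ereal_inf_tmp => _ [rho [[_ rho0] _] <-]; exact: mint_ge0.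
apply/lee_addgt0Pr => eps eps0; rewrite add0e.
have lam0 : 0 < lam by exact: lt_le_trans lam1.
(* One weight for each scale [n.+1%:R^-1], with summable integrals. *)
have /choice[rho hrho] : forall n : nat, exists rho : X -> \bar R,
    [/\ nonneg_borel_fun rho, (mint mu setT rho <= (eps / 2 ^+ n.+1)%:E)%E &
    forall (gamma : curve X) (t0 t1 : R), crosses mu E gamma t0 t1 ->
      8 * lam * n.+1%:R^-1 <= mdist (gamma t0) (gamma t1) ->
      (1 <= curve_integral gamma rho)%E].
  move=> n; apply: (exists_weight mu_regular mu_doubling mE CP0 lam1 PI vg).
    by rewrite divr_gt0// exprn_gt0.
  by rewrite invr_gt0.
have brho n : nonneg_borel_fun (rho n) by have [] := hrho n.
apply: (@le_trans _ _ (mint mu setT (borel_series rho))).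
  apply: ereal_inf_lbound; exists (borel_series rho) => //; split.
    exact: borel_series_nonneg_borel.
  move=> gamma /crossG[t0 [t1 cr]].
  have d0 : 0 < mdist (gamma t0) (gamma t1).
    rewrite mdist_gt0; apply/eqP => te.
    have [_ _ _ _ []] := cr; rewrite te => -[a b].
      exact: (vanishing_excl mu_doubling mE a b).
    exact: (vanishing_excl mu_doubling mE b a).
  pose n := Num.truncn (8 * lam / mdist (gamma t0) (gamma t1)).
  have [_ _ /(_ gamma t0 t1 cr) hn] := hrho n.
  apply: le_trans (curve_integral_borel_series brho gamma n).
  apply: hn; rewrite ler_pdivrMr// [leRHS]mulrC -ler_pdivrMr//.
  exact: ltW (truncnS_gt _).
apply: (mint_borel_series mu_regular brho) => N.
have main : (\sum_(0 <= n < N) mint mu setT (rho n) <= (eps * (1 - (2 ^+ N)^-1))%:E)%E.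
  elim: N => [|N IH]; first by rewrite big_nil expr0 invr1 subrr mulr0.
  rewrite big_nat_recr//=; have [_ hN _] := hrho N.
  apply: (le_trans (leeD IH hN)); rewrite -EFinD lee_fin -mulrDr ler_wpM2l ?(ltW eps0)//.
  by rewrite exprS invfM; lra.
apply: (le_trans main); rewrite lee_fin; apply: ler_piMr; first exact: ltW.
by rewrite gerBl invr_ge0 exprn_ge0.
Qed.
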